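(* Let $\mu,v\in\mathbb R$ and $t>0$. For $y>v$, $$ P\Big\{B^\mu(t)\in\mathrm dy\ \Big|\ \inf_{0<z<t}B^\mu(z)>v,\ B^\mu(0)=v\Big\}=\frac{(y-v)\,e^{-\frac{(y-v)^2}{2t}}\,e^{\mu y}}{\int_v^\infty(w-v)\,e^{-\frac{(w-v)^2}{2t}}\,e^{\mu w}\,\mathrm dw}\,\mathrm dy . $$ In particular, for $\mu=0$, $$ P\Big\{B(t)\in\mathrm dy\ \Big|\ \inf_{0<z<t}B(z)>v,\ B(0)=v\Big\}=\frac{y-v}{t}\,e^{-\frac{(y-v)^2}{2t}}\,\mathrm dy,\qquad y>v . $$
   Context: $B$ is a standard one-dimensional Brownian motion and $B^\mu(t)=B(t)+\mu t$ is Brownian motion with drift $\mu$; conditioning on $B^\mu(0)=u$ means that the process is started at $u$. The law $P\{\cdot\mid\inf_{0<z<t}B^\mu(z)>v,\ B^\mu(0)=v\}$ is the weak limit on $C[0,t]$, as $u\downarrow v$ (with $u>v$), of the laws $P\{\cdot\mid\min_{0\le z\le t}B^\mu(z)>v,\ B^\mu(0)=u\}$ obtained by elementary conditioning on the positive-probability event $\{\min_{0\le z\le t}B^\mu(z)>v\}$. *)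

(* Defs.v *)
From HB Require Import structures.
From mathcomp Require Import all_boot all_order all_algebra.
From mathcomp Require Import all_classical all_reals all_analysis.
From mathcomp Require Import lra.

Set Implicit Arguments.
Unset Strict Implicit.
Unset Printing Implicit Defensive.

Import Order.TTheory GRing.Theory Num.Theory.
Import numFieldNormedType.Exports.

Local Open Scope classical_set_scope.
Local Open Scope ring_scope.

(** The path space C[0,t]: continuous functions on the subtype [0,t], with the
    topology of the uniform distance and its Borel sigma-algebra. *)
Definition cpath (R : realType) (t : R) : Type :=
  continuousType (set_type `[0, t]%classic) R.

Section cpath_instances.
Context (R : realType) (t : R).

Definition cpath_fun (w : cpath t) : arrow_uniform_type `[0, t]%classic R := w.

HB.instance Definition _ := Choice.on (cpath t).
HB.instance Definition _ := isPointed.Build (cpath t) (cst 0).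
HB.instance Definition _ :=
  PseudoMetric.copy (cpath t) (initial_topology cpath_fun).
HB.instance Definition _ :=
  Measurable.copy (cpath t) (g_sigma_algebraType (@open (cpath t))).

End cpath_instances.

Section cpath_theory.
Context (R : realType) (t : R).
Local Notation I := (set_type `[0, t]%classic).

Lemma cpath_ballE (w w' : cpath t) (e : R) :
  ball w e w' <-> forall s : I, `|w s - w' s| < e.
Proof. by []. Qed.

Lemma cpath_within (w : cpath t) :
  {within `[0, t], continuous (valL_ 0 w)}.
Proof. exact/subspace_valL_continuousP'/cts_fun. Qed.

Lemma cpath_valL (w : cpath t) (s : I) : valL_ 0 w (set_val s) = w s.
Proof. by rewrite -[in RHS](@valLK _ _ 0 _ w). Qed.

Lemma cpath_unif (w : cpath t) (e : R) : 0 < e -> exists n : nat,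
  forall s s' : I, `|set_val s - set_val s'| < n.+1%:R^-1 -> `|w s - w s'| < e.
Proof.
move=> e0; pose f : R -> R := valL_ 0 w.
have cf : {within `[0, t], continuous f} := @cpath_within w.
pose P (n : nat) (x : R) := x \in `[0, t] -> forall y, y \in `[0, t] ->
  `|x - y| < n.+1%:R^-1 -> `|f x - f y| < e.
have tri (x y z d : R) : `|x - y| < d / 2 -> `|y - z| < d / 2 -> `|x - z| < d.
  move=> xy yz; rewrite (_ : x - z = (x - y) + (y - z)); last by lra.
  by apply: le_lt_trans (ler_normD _ _) _; lra.
have : \forall n \near \oo, `[0, t] `<=` P n.
  apply: (compact_near_coveringP _).1; first exact: segment_compact.
  move=> x xt.
  move: (cf); rewrite continuous_subspace_in => /(_ x).
  move=> /(_ (mem_set xt)) /cvgrPdist_lt /(_ (e / 2) ltac:(by lra)).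
  rewrite /nbhs/= -nbhs_subspace_in; last exact: xt.
  move=> /nbhs_ballP[d /= d0 dP].
  have {}dP y : y \in `[0, t] -> `|x - y| < d -> `|f x - f y| < e / 2.
    by move=> yt xy; apply: dP.
  have := near_infty_natSinv_lt (PosNum (divr_gt0 d0 (@ltr0n R 2))) => -[N _ /= NP].
  exists (ball x (d / 2), [set n | (N <= n)%N]); first split => /=.
  - by apply: nbhsx_ballx; lra.
  - by exists N.
  move=> [x' n] /= [xx' Nn] x't y yt x'y.
  have n2 : n.+1%:R^-1 < d / 2 :> R by exact: NP.
  have A : `|f x - f x'| < e / 2.
    by apply: dP => //; apply: lt_le_trans xx' _; lra.
  have B : `|f x - f y| < e / 2.
    by apply: dP => //; apply: (tri _ x') => //; exact: lt_trans n2.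
  by apply: (tri _ (f x)) => //; rewrite distrC.
move=> [n _ /(_ n (leqnn n)) nP].
exists n => s s' ss'; rewrite -!cpath_valL.
have /= st := set_valP s; have /= s't := set_valP s'.
exact: (nP (set_val s) st st (set_val s') s't ss').
Qed.

Lemma cpath_dense (s : I) (d : R) : 0 < d ->
  exists (r : rat) (s' : I), set_val s' = ratr r /\ `|set_val s - set_val s'| < d.
Proof.
move=> d0; have := set_valP s; rewrite /= in_itv/=.
have -> : \val s = set_val s by [].
have [t0|t0] := ltP 0 t; last first.
  move=> /andP[s0 st]; have {}s0 : set_val s = 0.
    by apply/eqP; rewrite eq_le s0 (le_trans st).
  by exists 0, s; rewrite subrr normr0 s0 rmorph0.
move: (set_val s : R) => x /andP[s0 st].
have [q] : exists q : rat,
    ratr q \in `]Num.max 0 (x - d), Num.min t (x + d)[.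
  by apply: rat_in_itvoo; rewrite gt_max !lt_min; apply/andP; split; apply/andP; split; lra.
rewrite in_itv/= gt_max lt_min => /andP[/andP[q0 qd] /andP[qt qd']].
have qI : ratr q \in `[0, t]%classic by rewrite inE/= in_itv/= !ltW.
exists q, (exist (fun x : R => x \in `[0, t]%classic) (ratr q) qI); split=> //.
by rewrite set_valE/= ltr_distlC; apply/andP; split; lra.
Qed.

(** C[0,t] is separable: every open set is a countable union of the sets [cyl i]
    (paths within 1/(m+1) of a rational step function at all rational times), so a
    map into C[0,t] with measurable coordinates is Borel measurable. *)
Let step (n : nat) (q : seq rat) (x : R) : R :=
  ratr (nth 0 q (Num.truncn (x * n.+1%:R))).

Let cyl (i : nat * nat * seq rat) : set (cpath t) := [set w |
  forall (r : rat) (s : I), set_val s = ratr r ->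
    `|w s - step i.1.1 i.2 (ratr r)| <= i.1.2.+1%:R^-1].

Lemma cpath_measurable d (T : measurableType d) (X : T -> cpath t) :
  (forall s : I, measurable_fun [set: T] (fun x => X x s)) ->
  measurable_fun [set: T] X.
Proof.
move=> mX; apply: (measurability (@open (cpath t))) => // _ [U oU <-].
rewrite setTI (_ : _ @^-1` U =
    \bigcup_i if `[< cyl i `<=` U >] then X @^-1` cyl i else set0).
  apply: countable_bigcupT_measurable => // i; case: ifPn => // _.
  rewrite (_ : _ @^-1` _ = \bigcap_(r : rat) [set x | forall s : I,
      set_val s = ratr r -> `|X x s - step i.1.1 i.2 (ratr r)| <= i.1.2.+1%:R^-1]).
    rewrite -[X in measurable X]setCK; apply: measurableC; rewrite setC_bigcap.
    apply: countable_bigcupT_measurable => // r; apply: measurableC.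
    have [rI|rI] := pselect (ratr r \in `[0, t]%classic : Prop); last first.
      rewrite (_ : [set _ | _] = setT)//; apply/seteqP; split=> // x _ s sr.
      by case: rI; rewrite -sr; exact/mem_set/set_valP.
    pose s0 : I := exist (fun x : R => x \in `[0, t]%classic) _ rI.
    rewrite (_ : [set _ | _] = (fun x => `|X x s0 - step i.1.1 i.2 (ratr r)|)
        @^-1` `]-oo, i.1.2.+1%:R^-1]); last first.
      apply/seteqP; split=> x /=; rewrite in_itv/=; first by apply.
      by move=> H s sr; rewrite (_ : s = s0)//; apply/val_inj.
    rewrite -[X in measurable X]setTI.
    apply: (_ : measurable_fun setT _) => //.
    apply: measurableT_comp => //.
    by apply: measurable_realfun.measurable_funB => //; exact: mX.
  by apply/seteqP; split=> [x H r _|x H r s /H]; [exact: H|exact].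
apply/seteqP; split=> [x Ux|x [i _]]; last first.
  by case: ifPn => [/asboolP iU /iU|//].
have /nbhs_ballP[e /= e0 eU] : nbhs (X x) U by exact: open_nbhs_nbhs.
have e4 : 0 < e / 4 by lra.
have [m _ /(_ m (leqnn m)) /= me] := near_infty_natSinv_lt (PosNum e4).
have m0 : 0 < m.+1%:R^-1 / 2 :> R by rewrite divr_gt0 // invr_gt0.
have [n nP] := cpath_unif (X x) m0.
have /boolp.choice[g gP] : forall k : nat, exists q : rat,
    `|valL_ 0 (X x) (k%:R / n.+1%:R) - ratr q| < m.+1%:R^-1 / 2.
  move=> k; set y := valL_ _ _ _.
  have [q] : exists q : rat, ratr q \in `]y - m.+1%:R^-1 / 2, y + m.+1%:R^-1 / 2[.
    by apply: rat_in_itvoo; move: m0; move: (_ / _) => z; lra.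
  by rewrite in_itv/= => qy; exists q; rewrite ltr_distlC.
pose q := mkseq g (Num.truncn (t * n.+1%:R)).+1.
have n0 : 0 < n.+1%:R :> R by [].
have cw : cyl (n, m, q) (X x).
  move=> r s sr /=; have := set_valP s; rewrite /= in_itv/=.
  have -> : \val s = set_val s by []; rewrite sr => /andP[r0 rt].
  rewrite /step; set k := Num.truncn _.
  have : (k%:R <= ratr r * n.+1%:R :> R) && (ratr r * n.+1%:R < k.+1%:R :> R).
    by apply: truncn_itv; rewrite mulr_ge0.
  move=> /andP[k1 k2].
  rewrite nth_mkseq; last first.
    by rewrite ltnS; apply: le_truncn; rewrite ler_pM2r.
  have kr : k%:R / n.+1%:R <= ratr r :> R by rewrite ler_pdivrMr.
  have kI : (k%:R / n.+1%:R : R) \in `[0, t]%classic.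
    by rewrite inE/= in_itv/= divr_ge0//= (le_trans kr).
  pose s0 : I := exist (fun x : R => x \in `[0, t]%classic) _ kI.
  have /nP : `|set_val s - set_val s0| < n.+1%:R^-1.
    rewrite sr set_valE/= ger0_norm ?subr_ge0//.
    by rewrite ltrBlDr -(@ltr_pM2r _ n.+1%:R)// mulrDl divfK ?gt_eqF// mulVf ?gt_eqF// -natr1 in k2 *; lra.
  rewrite -(cpath_valL (X x) s0) set_valE/= => A.
  have B := gP k.
  rewrite (_ : X x s - _ = (X x s - valL_ 0 (X x) (k%:R / n.+1%:R)) + (valL_ 0 (X x) (k%:R / n.+1%:R) - ratr (g k))); last by lra.
  apply: le_trans (ler_normD _ _) _; rewrite [leRHS]splitr.
  exact/ltW/(ltrD A B).
exists (n, m, q) => //; case: ifPn => [//|/asboolP[]].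
move=> w' cw'; apply: eU; apply/cpath_ballE => s.
have e8 : 0 < e / 8 by lra.
have [n1 n1P] := cpath_unif (X x) e8.
have [n2 n2P] := cpath_unif w' e8.
have [r [s' [s'r]]] : exists (r : rat) (s' : I), set_val s' = ratr r /\
    `|set_val s - set_val s'| < Num.min n1.+1%:R^-1 n2.+1%:R^-1.
  by apply: cpath_dense => //; rewrite lt_min !invr_gt0 !ltr0n.
rewrite lt_min => /andP[/n1P A1 /n2P A2].
have A3 := cw' _ _ s'r; have A4 := cw _ _ s'r; rewrite /= in A3 A4.
move: A3 A4; move: (step _ _ _) => y A3 A4.
have far (a b c z m' : R) : m' < e / 4 -> `|a - b| < e / 8 -> `|b - z| <= m' ->
    `|c - z| <= m' -> forall c', `|c' - c| < e / 8 -> `|a - c'| < e.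
  rewrite !ltr_norml !ler_norml => h1 /andP[h2 h3] /andP[h4 h5] /andP[h6 h7] c'.
  by rewrite !ltr_norml => /andP[h8 h9]; apply/andP; split; lra.
exact: (far _ _ _ _ _ me A1 A4 A3).
Qed.

Lemma open_inf_gt (v : R) : open [set w : cpath t | v < inf (range w)].
Proof.
rewrite openE => w /= vw.
have [t0|t0] := ltP t 0.
  have e0 (w1 : cpath t) : range w1 = set0.
    apply/seteqP; split=> // y [s _ _]; have := set_valP s.
    by rewrite /= in_itv/= => /andP[s0 st]; lra.
  by apply/nbhs_ballP; exists 1 => //= w' _ /=; rewrite (e0 w') -(e0 w).
have I0 : 0 \in `[0, t]%classic by rewrite inE/= in_itv/= lexx.
pose s0 : I := exist (fun x : R => x \in `[0, t]%classic) _ I0.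
have lbw : has_lbound (range w).
  have [c ct cP] := EVT_min t0 (@cpath_within w).
  exists (valL_ 0 w c) => _ [s _ <-]; rewrite -cpath_valL.
  by apply: cP; have := set_valP s.
pose e := (inf (range w) - v) / 2.
have e0 : 0 < e by rewrite /e; lra.
apply/nbhs_ballP; exists e => //= w' /cpath_ballE ww'.
apply: (@lt_le_trans _ _ (inf (range w) - e)); first by rewrite /e; lra.
apply: lb_le_inf; first by exists (w' s0); exists s0.
move=> _ [s _ <-].
have : inf (range w) <= w s by apply: ge_inf => //; exists s.
by have := ww' s; rewrite ltr_distl => /andP[]; lra.
Qed.

Lemma measurable_inf_gt (v : R) :
  measurable [set w : cpath t | v < inf (range w)].
Proof. by apply: sub_sigma_algebra; exact: open_inf_gt. Qed.

End cpath_theory.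

(** A standard Brownian motion on [(Omega, P)]: time is the half-line [0 <= s]
    of [R], and the values at negative times play no role. *)
Record brownian_motion d (Omega : measurableType d) (R : realType)
    (P : probability Omega R) := BrownianMotion {
  bm :> R -> {RV P >-> R} ;
  bm_start : {ae P, forall x, bm 0 x = 0} ;
  bm_continuous : forall x, {within `[0, +oo[, continuous (fun s : R => bm s x : R)} ;
  bm_normal : forall s s' : R, 0 <= s < s' -> forall A : set R, measurable A ->
    P [set x | A (bm s' x - bm s x)] = normal_prob 0 (Num.sqrt (s' - s)) A ;
  bm_independent : forall (n : nat) (s : nat -> R) (A : nat -> set R),
    0 <= s 0%N -> {homo s : i j / (i <= j)%N >-> i <= j} ->
    (forall i, measurable (A i)) ->
    P [set x | forall i, (i < n)%N -> A i (bm (s i.+1) x - bm (s i) x)] =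
    (\prod_(i < n) P [set x | A i (bm (s i.+1) x - bm (s i) x)%R])%E
}.

Section conditioned_law.
Context d (Omega : measurableType d) (R : realType) (P : probability Omega R).
Context (B : brownian_motion P) (mu : R).

Section path.
Context (t u : R).

Lemma drift_continuous (x : Omega) : continuous
  (fun s : set_type `[0, t]%classic => u + (B (set_val s) x + mu * set_val s)).
Proof.
move=> s.
have vc : continuous (set_val : set_type `[0, t]%classic -> R).
  exact: initial_continuous.
have Bc : continuous (fun s : set_type `[0, t]%classic => B (set_val s) x).
  apply/(subspace_sigL_continuousP `[0, t]%classic (fun s : R => B s x : R)).
  apply: continuous_subspaceW (@bm_continuous _ _ _ _ B x) => y /=.
  by rewrite !in_itv/= => /andP[->].
have muc : continuous (fun s : set_type `[0, t]%classic => mu * set_val s).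
  move=> z; apply: (continuous_comp (vc z)); exact: mulrl_continuous.
have Bmc : {for s, continuous
    (fun s : set_type `[0, t]%classic => B (set_val s) x + mu * set_val s)}.
  exact: (@continuousD R R^o _ _ _ s (Bc s) (muc s)).
have H := (@continuousD R R^o _ (cst u) _ s (@cst_continuous _ _ u s) Bmc).
exact H.
Qed.

(** The path on [0,t] of [B^mu] started at [u]. *)
Definition drift_path (x : Omega) : cpath t := mkcts (@drift_continuous x).

Lemma measurable_drift_path : measurable_fun [set: Omega] drift_path.
Proof.
apply: cpath_measurable => s.
apply: measurable_realfun.measurable_funD => //.
by apply: measurable_realfun.measurable_funD.
Qed.

HB.instance Definition _ :=
  isMeasurableFun.Build _ _ _ _ drift_path measurable_drift_path.

Definition drift_law : probability (cpath t) R := distribution P drift_path.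

(** Elementary conditioning of the path law on [min_{0<=z<=t} w z > v]; the
    infimum of a continuous function on [0,t] is its minimum. The second
    argument of [mnormalize] is only used when the event is null. *)
Definition conditioned_drift_law (v : R) : probability (cpath t) R :=
  mnormalize (mrestr drift_law (@measurable_inf_gt R t v)) drift_law.

End path.

(** [Q] is the law of [B^mu] on [0,t] started at [v] and conditioned to stay
    above [v]: the weak limit of the conditioned laws as [u] decreases to [v]. *)
Definition meander_law (t v : R) (Q : probability (cpath t) R) : Prop :=
  forall f : cpath t -> R, continuous f -> bounded_fun f ->
  (\int[conditioned_drift_law t u v]_(w in setT) f w)%R @[u --> v^'+] -->
  (\int[Q]_(w in setT) f w)%R.

End conditioned_law.

Lemma endpoint_subproof (R : realType) (t : R) : 0 < t -> t \in `[0, t]%classic.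
Proof. by move=> t0; rewrite inE/= in_itv/= lexx ltW. Qed.

Definition endpoint (R : realType) (t : R) (t0 : 0 < t) :
  set_type `[0, t]%classic :=
  exist (fun x : R => x \in `[0, t]%classic) t (endpoint_subproof t0).

(* Main.v *)
From HB Require Import structures.
Require Import Defs.
From mathcomp Require Import all_boot all_order all_algebra.
From mathcomp Require Import all_classical all_reals all_analysis.
From mathcomp Require Import measurable_realfun ring lra.
Set Implicit Arguments.
Unset Strict Implicit.
Unset Printing Implicit Defensive.
Import Order.TTheory GRing.Theory Num.Theory.
Import numFieldNormedType.Exports.
Local Open Scope classical_set_scope.
Local Open Scope ring_scope.

(** For a starting point [u > v], the path stays above [v] on [0, t] and ends in
    [dy] with probability
    [exp (mu (y - u) - mu ^+ 2 t / 2) (p (y - u) - p (2 v - y - u)) dy], where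
    [p] is the Gaussian density of variance [t]: this is the reflection
    principle, with the drift put in by a change of measure ([stay_law]). The
    difference of the two Gaussians is, up to a factor free of [y],
    [exp (- (y - v) ^+ 2 / (2 t)) sinh ((y - v) (u - v) / t)]
    ([stay_densityE]). The factor cancels in the conditional law, and
    [sinh ((y - v) (u - v) / t) / (u - v)] tends to [(y - v) / t] as [u]
    decreases to [v], which leaves the weight
    [(y - v) exp (- (y - v) ^+ 2 / (2 t)) exp (mu y)], to be normalised.

    The reflection principle is obtained without stopping times. At the times
    [k t / N] Brownian motion is a Markov chain with Gaussian steps
    ([walk_killed]), so the expectation of a function of its endpoint, on the
    event that it is above the barrier at these times, is an iterate of the heat
    operator with killing; for this iterate the drift can be exchanged for an
    exponential tilt, one step at a time ([killed_drift]). By induction on the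
    number of steps, the iterate is bounded below by the solution that the
    method of images gives for the same barrier ([killed_lower]), and above by
    the solution for a barrier lowered by [e], up to [N] times the probability
    of a step of size [e] ([killed_upper]). That error is of order
    [N exp (- e ^+ 2 N / (2 t))]. Continuity of paths turns the event at grid
    times into the event about the minimum ([stay_upper], [stay_lower]), and
    then [e] tends to 0.

    The passage to the limit [u] to [v] is by dominated convergence, the
    dominating function being the density for a starting point at distance 2
    from the barrier. A bounded continuous function of the endpoint is a bounded
    continuous functional of the path, so the limit law of the endpoint is known
    on such functions ([meander_endpoint_expectation]), hence on half-lines and
    on all Borel sets. Without drift the normalising constant is [t], by an
    explicit primitive ([rayleigh_mass]). *)

(** * Integration against a density *)

Section density.
Context d (T : measurableType d) (R : realType).
Variables (m mu : {measure set T -> \bar R}) (rho : T -> R).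
Hypothesis mrho : measurable_fun setT rho.
Hypothesis rho0 : forall x, 0 <= rho x.
Hypothesis mE : forall A, measurable A -> m A = (\int[mu]_(x in A) (rho x)%:E)%E.

Import HBNNSimple.

Local Open Scope ereal_scope.

Let density_nnsfun (f : {nnsfun T >-> R}) :
  \int[m]_x (f x)%:E = \int[mu]_x ((f x)%:E * (rho x)%:E).
Proof.
under eq_integral do rewrite fimfunE -fsumEFin//.
rewrite ge0_integral_fsum//; last 2 first.
  - by move=> ?; apply/measurable_EFinP; exact/measurableT_comp.
  - by move=> ? x _; rewrite EFinM nnfun_muleindic_ge0.
under [RHS]eq_integral => x _.
  rewrite fimfunE -fsumEFin// ge0_mule_fsuml; last first.
    by move=> ?; rewrite EFinM nnfun_muleindic_ge0.
  over.
rewrite [RHS]ge0_integral_fsum//; last 2 first.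
  - move=> ?; apply: emeasurable_funM; apply/measurable_EFinP => //.
    exact/measurableT_comp.
  - by move=> ? x _; rewrite mule_ge0 ?lee_fin// -lee_fin EFinM nnfun_muleindic_ge0.
apply: eq_fsbigr => r _; have [r_ge0|r_lt0] := leP 0%R r; last first.
  rewrite preimage_nnfun0//.
  by rewrite !integral0_eq// => x _; rewrite indic0 ?mulr0 ?mul0e.
under eq_integral do rewrite EFinM.
under [RHS]eq_integral do rewrite EFinM -muleA.
rewrite !ge0_integralZl//=; last 3 first.
  - by apply: emeasurable_funM; exact/measurable_EFinP.
  - by move=> x _; rewrite mule_ge0// lee_fin.
  - exact/measurable_EFinP.
rewrite integral_indic// setIT mE//; congr (_ * _).
rewrite integral_mkcond; apply: eq_integral => x _.
by rewrite patchE indicE; case: ifPn => _; rewrite ?mul1e ?mul0e.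
Qed.

Lemma ge0_integral_density (f : T -> \bar R) :
  measurable_fun setT f -> (forall x, 0 <= f x) ->
  \int[m]_x f x = \int[mu]_x (f x * (rho x)%:E).
Proof.
move=> mf f0; pose f_ := nnsfun_approx measurableT mf.
have mf_ n : measurable_fun setT (fun x => (f_ n x)%:E) by exact/measurable_EFinP.
transitivity (limn (fun n => \int[m]_x (f_ n x)%:E)).
  rewrite -monotone_convergence//=.
  - by apply: eq_integral => x _; apply/esym/cvg_lim => //=; exact: cvg_nnsfun_approx.
  - by move=> n x _; rewrite lee_fin.
  - by move=> x _ a b ab; rewrite lee_fin//; exact/lefP/nd_nnsfun_approx.
rewrite (_ : \int[mu]_x _ =
    limn (fun n => \int[mu]_x ((f_ n x)%:E * (rho x)%:E))); last first.
  rewrite -monotone_convergence//=.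
  - apply: eq_integral => x _; apply/esym/cvg_lim => //.
    by apply: cvgeZr => //; exact: cvg_nnsfun_approx.
  - by move=> n; apply: emeasurable_funM => //; exact/measurable_EFinP.
  - by move=> n x _; rewrite mule_ge0// lee_fin.
  - move=> x _ a b ab; rewrite lee_wpmul2r// lee_fin//.
    exact/lefP/nd_nnsfun_approx.
by congr (limn _); apply/funext => n /=; rewrite density_nnsfun.
Qed.

End density.

(** * Reflections and translations of the Lebesgue integral *)

Section lebesgue_reflection.
Context (R : realType).
Local Notation leb := (@lebesgue_measure R).

Definition reflection (a : R) : measurableTypeR R -> measurableTypeR R :=
  fun y => a - y.

Lemma measurable_reflection (a : R) : measurable_fun setT (reflection a).
Proof. exact: measurable_funB. Qed.

Lemma lebesgue_measure_reflection (a : R) (A : set R) : measurable A ->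
  pushforward leb (reflection a) A = leb A.
Proof.
move=> mA; apply/esym/lebesgue_measure_unique => //=.
  exact: measurable_reflection.
move=> mphi _ [[b c]] _ <-.
rewrite /pushforward (_ : _ @^-1` _ = `[a - c, a - b[%classic); last first.
  by apply/seteqP; split => x /=; rewrite !in_itv/= /reflection; lra.
by rewrite !lebesgue_measure_itv/= !lte_fin ltrD2l ltrN2 -EFinB -EFinD;
  case: ifPn => // _; congr (_%:E); ring.
Qed.

(** The affine isometries of the line preserve Lebesgue measure; reflections are
    all that is needed, since a translation is a product of two of them. *)
Lemma ge0_integral_reflection (a : R) (f : R -> \bar R) :
  measurable_fun setT f -> (forall x, (0 <= f x)%E) ->
  (\int[leb]_y f (a - y)%R = \int[leb]_y f y)%E.
Proof.
move=> mf f0.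
transitivity (\int[pushforward leb (reflection a)]_y f y)%E.
  by rewrite ge0_integral_pushforward//; exact: measurable_reflection.
apply: eq_measure_integral => [|mr A mA _]; first exact: measurable_reflection.
exact: lebesgue_measure_reflection.
Qed.

End lebesgue_reflection.

(** * The Gaussian kernel *)

Section gaussian_kernel.
Context (R : realType).
Local Notation leb := (@lebesgue_measure R).

(** The second parameter of [normal_pdf] is a standard deviation; here [s] is the
    variance, that is, a time. *)
Definition gauss (s z : R) : R := normal_pdf 0 (Num.sqrt s) z.

Lemma gaussE (s z : R) : 0 < s ->
  gauss s z = (Num.sqrt (s * pi *+ 2))^-1 * expR (- (z ^+ 2 / (2 * s))).
Proof.
move=> s0; rewrite /gauss normal_pdfE ?gt_eqF ?sqrtr_gt0//.
rewrite /normal_peak /normal_fun sqr_sqrtr ?ltW// subr0 mulNr.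
by congr (_ * expR (- (_ / _))); ring.
Qed.

Lemma gauss_ge0 (s z : R) : 0 <= gauss s z.
Proof. exact: normal_pdf_ge0. Qed.

Lemma gaussN (s z : R) : 0 < s -> gauss s (- z) = gauss s z.
Proof. by move=> s0; rewrite !gaussE// sqrrN. Qed.

(** Among points at a given time, the nearer one carries more mass. All the sign
    information in the reflection argument comes from this. *)
Lemma le_gauss (s z w : R) : 0 < s -> w ^+ 2 <= z ^+ 2 -> gauss s z <= gauss s w.
Proof.
move=> s0 wz; rewrite !gaussE// ler_wpM2l ?invr_ge0 ?sqrtr_ge0//.
by rewrite ler_expR lerN2 ler_pM2r// invr_gt0 mulr_gt0.
Qed.

Lemma measurable_gauss d (T : measurableType d) (s : R) (D : set T) (f : T -> R) :
  measurable_fun D f -> measurable_fun D (fun x => gauss s (f x)).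
Proof. by apply: measurableT_comp; exact: measurable_normal_pdf. Qed.

Lemma continuous_gauss (s : R) : 0 < s -> continuous (gauss s).
Proof. by move=> s0; apply: continuous_normal_pdf; rewrite gt_eqF ?sqrtr_gt0. Qed.

Lemma integral_gauss (s x : R) : 0 < s ->
  (\int[leb]_y (gauss s (y - x))%:E = 1)%E.
Proof.
move=> s0; under eq_integral do rewrite -gaussN// opprB.
rewrite (ge0_integral_reflection x (f := fun y => (gauss s y)%:E)).
- exact: integral_normal_pdf.
- by apply/measurable_EFinP; exact: measurable_gauss.
- by move=> y; rewrite lee_fin gauss_ge0.
Qed.

(** Completing the square in the middle point [y]: the second factor on the right
    is the density of the Brownian bridge from [x] to [z]. *)
Lemma gauss_gauss (s h x y z : R) : 0 < s -> 0 < h ->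
  gauss h (y - x) * gauss s (z - y) = gauss (h + s) (z - x) *
    gauss (h * s / (h + s)) (y - (x + h * (z - x) / (h + s))).
Proof.
move=> s0 h0; have hs0 : 0 < h + s by lra.
rewrite !gaussE ?divr_gt0 ?mulr_gt0//.
rewrite mulrACA [RHS]mulrACA -!expRD; congr (_ * expR _); last first.
  by field; rewrite !gt_eqF.
rewrite -!invfM -!sqrtrM; last 2 first.
- by rewrite mulrn_wge0// mulr_ge0 ?pi_ge0// ltW.
- by rewrite mulrn_wge0// mulr_ge0 ?pi_ge0// ltW.
by congr (Num.sqrt _)^-1; field; rewrite gt_eqF.
Qed.

(** One-step change of drift: the density of a drifted step relative to the
    driftless one is the exponential martingale. *)
Lemma gauss_shift (mu s z : R) : 0 < s ->
  gauss s (z - mu * s) = expR (mu * z - mu ^+ 2 * s / 2) * gauss s z.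
Proof.
move=> s0; rewrite !gaussE// mulrCA -expRD; congr (_ * expR _).
by field; rewrite gt_eqF.
Qed.

End gaussian_kernel.

(** * The heat operator and the method of images *)

Section heat.
Context (R : realType).
Local Notation leb := (@lebesgue_measure R).
Local Open Scope ereal_scope.
Implicit Types (g f : R -> \bar R) (mu s h c x y : R).

(** Transition operator of Brownian motion with drift [mu] over a time [s]. *)
Definition heat mu s g x := \int[leb]_y (g y * (gauss s (y - x - mu * s))%:E).

Let measurable_integrand mu s g x : measurable_fun setT g ->
  measurable_fun setT (fun y => g y * (gauss s (y - x - mu * s))%:E).
Proof.
move=> mg; apply: emeasurable_funM => //; apply/measurable_EFinP.
by apply: measurable_gauss; do 2 apply: measurable_funB => //.
Qed.

Let integrand_ge0 mu s g x y : (forall y, 0 <= g y) ->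
  0 <= g y * (gauss s (y - x - mu * s))%:E.
Proof. by move=> g0; rewrite mule_ge0// lee_fin gauss_ge0. Qed.

Hint Resolve measurable_integrand integrand_ge0 : core.

Lemma heat_ge0 mu s g x : (forall y, 0 <= g y) -> 0 <= heat mu s g x.
Proof. by move=> g0; apply: integral_ge0 => y _; exact: integrand_ge0. Qed.

Lemma measurable_heat mu s g : measurable_fun setT g -> (forall y, 0 <= g y) ->
  measurable_fun setT (heat mu s g).
Proof.
move=> mg g0.
pose F (z : R * R) := g z.2 * (gauss s (z.2 - z.1 - mu * s))%:E.
apply: (@measurable_fun_fubini_tonelli_F _ _ _ _ _ leb F).
  apply: emeasurable_funM; first exact: measurableT_comp.
  apply/measurable_EFinP/measurable_gauss.
  by do 2 apply: measurable_funB => //.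
by move=> z; rewrite mule_ge0// lee_fin gauss_ge0.
Qed.

Lemma le_heat mu s g f x : measurable_fun setT g -> (forall y, 0 <= g y) ->
  measurable_fun setT f -> (forall y, g y <= f y) ->
  heat mu s g x <= heat mu s f x.
Proof.
move=> mg g0 mf gf; apply: ge0_le_integral => //.
- by move=> y _; exact: integrand_ge0.
- exact: measurable_integrand.
- exact: measurable_integrand.
- by move=> y _; rewrite lee_wpmul2r// lee_fin gauss_ge0.
Qed.

Lemma heatD mu s g f x : measurable_fun setT g -> (forall y, 0 <= g y) ->
  measurable_fun setT f -> (forall y, 0 <= f y) ->
  heat mu s (fun y => g y + f y) x = heat mu s g x + heat mu s f x.
Proof.
move=> mg g0 mf f0; rewrite /heat -ge0_integralD//.
- by apply: eq_integral => y _; rewrite ge0_muleDl.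
- by move=> y _; exact: integrand_ge0.
- exact: measurable_integrand.
- by move=> y _; exact: integrand_ge0.
- exact: measurable_integrand.
Qed.

Lemma heatZ mu s g x (k : R) : measurable_fun setT g -> (forall y, 0 <= g y) ->
  (0 <= k)%R -> heat mu s (fun y => k%:E * g y) x = k%:E * heat mu s g x.
Proof.
move=> mg g0 k0; rewrite /heat -ge0_integralZl//.
- by apply: eq_integral => y _; rewrite muleA.
- exact: measurable_integrand.
- by move=> y _; exact: integrand_ge0.
Qed.

Lemma heat_cst s x (k : R) : (0 < s)%R -> (0 <= k)%R -> heat 0 s (cst k%:E) x = k%:E.
Proof.
move=> s0 k0; rewrite /heat ge0_integralZl//.
- under eq_integral do rewrite mul0r subr0.
  by rewrite integral_gauss// mule1.
- apply/measurable_EFinP/measurable_gauss.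
  by do 2 apply: measurable_funB => //.
- by move=> y _; rewrite lee_fin gauss_ge0.
Qed.

Lemma heat_heat s h g x : (0 < s)%R -> (0 < h)%R ->
  measurable_fun setT g -> (forall y, 0 <= g y) ->
  heat 0 h (heat 0 s g) x = heat 0 (h + s) g x.
Proof.
move=> s0 h0 mg g0.
pose F (z : R * R) := g z.2 * (gauss s (z.2 - z.1))%:E * (gauss h (z.1 - x))%:E.
have mF : measurable_fun setT F.
  apply: emeasurable_funM.
    apply: emeasurable_funM; first exact: measurableT_comp.
    by apply/measurable_EFinP/measurable_gauss; apply: measurable_funB.
  by apply/measurable_EFinP/measurable_gauss; apply: measurable_funB.
have F0 z : 0 <= F z.
  by rewrite mule_ge0// ?mule_ge0// lee_fin gauss_ge0.
transitivity (\int[leb]_y \int[leb]_z F (y, z)).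
  apply: eq_integral => y _.
  have k0 : 0 <= (gauss h (y - x - 0 * h))%:E by rewrite lee_fin gauss_ge0.
  have f0 z : setT z -> 0 <= g z * (gauss s (z - y - 0 * s))%:E.
    by move=> _; exact: integrand_ge0.
  apply: etrans (esym (ge0_integralZr leb measurableT
    (measurable_integrand _ _ _ mg) f0 k0)) _.
  by apply: eq_integral => z _; rewrite /F/= !mul0r !subr0.
rewrite fubini_tonelli//; apply: eq_integral => z _.
have sh0 : (0 < h * s / (h + s))%R by rewrite divr_gt0 ?mulr_gt0 ?addr_gt0.
transitivity (\int[leb]_y (g z * (gauss (h + s) (z - x))%:E *
    (gauss (h * s / (h + s)) (y - (x + h * (z - x) / (h + s))))%:E)).
  apply: eq_integral => y _; rewrite /F/= -!muleA -!EFinM; congr (_ * _%:E).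
  by rewrite mulrC gauss_gauss.
rewrite ge0_integralZl//.
- by rewrite integral_gauss// mule1 mul0r subr0.
- by apply/measurable_EFinP/measurable_gauss; apply: measurable_funB.
- by move=> y _; rewrite lee_fin gauss_ge0.
- by rewrite mule_ge0// lee_fin gauss_ge0.
Qed.

(** Cameron--Martin for one step: the drift is traded for the tilt
    [exp (mu y)] of the function. *)
Lemma heat_drift mu h g x : (0 < h)%R ->
  measurable_fun setT g -> (forall y, 0 <= g y) ->
  heat mu h g x = (expR (- (mu * x) - mu ^+ 2 * h / 2))%:E *
    heat 0 h (fun y => (expR (mu * y))%:E * g y) x.
Proof.
move=> h0 mg g0.
have meg : measurable_fun setT (fun y => (expR (mu * y))%:E * g y).
  apply: emeasurable_funM => //.
  by apply/measurable_EFinP/measurableT_comp => //; exact: measurable_funM.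
rewrite /heat -ge0_integralZl//; last 2 first.
- exact: measurable_integrand.
- by move=> y _; rewrite !mule_ge0// lee_fin ?expR_ge0 ?gauss_ge0.
apply: eq_integral => y _; rewrite (gauss_shift mu)// mul0r subr0.
rewrite (_ : expR (mu * (y - x) - mu ^+ 2 * h / 2) =
  expR (- (mu * x) - mu ^+ 2 * h / 2) * expR (mu * y))%R; last first.
  by rewrite -expRD; congr expR; ring.
rewrite !EFinM. move: (gauss _ _)%:E => G; rewrite -!muleA.
by rewrite [X in _ = _ * X]muleCA [RHS]muleCA; congr (_ * _); rewrite muleCA.
Qed.

(** Reflecting the function in [c] amounts to letting the heat flow from the mirror
    image of the starting point. *)
Lemma heat_reflection c s g x : (0 < s)%R ->
  measurable_fun setT g -> (forall y, 0 <= g y) ->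
  heat 0 s (fun y => g (2 * c - y)%R) x =
  \int[leb]_y (g y * (gauss s (2 * c - y - x))%:E).
Proof.
move=> s0 mg g0; rewrite -(ge0_integral_reflection (2 * c)).
- apply: eq_integral => y _; rewrite mul0r subr0.
  by congr (_ * (gauss _ _)%:E); ring.
- apply: emeasurable_funM => //; apply/measurable_EFinP/measurable_gauss.
  by do 2 apply: measurable_funB => //.
- by move=> y; rewrite mule_ge0// lee_fin gauss_ge0.
Qed.

Let image_dist c x y : ((y - x) ^+ 2 - (2 * c - y - x) ^+ 2 =
  4 * ((y - c) * (c - x)))%R.
Proof. by ring. Qed.

Section half_line.
Variables (c s : R) (g : R -> \bar R).
Hypotheses (s0 : (0 < s)%R) (mg : measurable_fun setT g) (g0 : forall y, 0 <= g y).
Hypothesis gc : forall y, (y <= c)%R -> g y = 0.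

(** For [g] carried by the half-line above [c] and [x] below [c], every point of
    the support is nearer to the mirror image of [x] than to [x]. *)
Lemma heat_le_reflection x : (x <= c)%R ->
  heat 0 s g x <= heat 0 s (fun y => g (2 * c - y)%R) x.
Proof.
move=> xc; rewrite [leRHS](heat_reflection c x s0 mg g0).
apply: ge0_le_integral.
- exact: measurableT.
- by move=> y _; exact: integrand_ge0.
- exact: measurable_integrand.
- apply: emeasurable_funM => //; apply/measurable_EFinP/measurable_gauss.
  by do 2 apply: measurable_funB => //.
move=> y _; rewrite mul0r subr0; have [yc|yc] := leP y c.
  by rewrite gc// !mul0e.
rewrite lee_wpmul2l// lee_fin le_gauss// -subr_ge0 image_dist.
by rewrite mulr_ge0// mulr_ge0// subr_ge0// ltW.
Qed.

Lemma heat_ge_reflection x : (c <= x)%R ->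
  heat 0 s (fun y => g (2 * c - y)%R) x <= heat 0 s g x.
Proof.
move=> cx; rewrite [leLHS](heat_reflection c x s0 mg g0).
apply: ge0_le_integral.
- exact: measurableT.
- by move=> y _; rewrite mule_ge0// lee_fin gauss_ge0.
- apply: emeasurable_funM => //; apply/measurable_EFinP/measurable_gauss.
  by do 2 apply: measurable_funB => //.
- exact: measurable_integrand.
move=> y _; rewrite mul0r subr0; have [yc|yc] := leP y c.
  by rewrite gc// !mul0e.
rewrite lee_wpmul2l// lee_fin le_gauss// -subr_le0 image_dist.
have : (0 <= (y - c) * (x - c))%R by rewrite mulr_ge0// subr_ge0// ltW.
by nra.
Qed.

End half_line.

(** Since [z <= - e] implies [z ^+ 2 >= e ^+ 2 + (z + e) ^+ 2], the Gaussian
    density at [z] is at most [exp (- e ^+ 2 / (2 h))] times the density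
    at [z + e]. *)
Lemma heat_tail c e h x : (0 < h)%R -> (0 < e)%R -> (c < x)%R ->
  heat 0 h (fun y => (\1_`]-oo, (c - e)%R] y)%:E) x <= (expR (- (e ^+ 2 / (2 * h))))%:E.
Proof.
move=> h0 e0 cx; rewrite -[leRHS]mule1 -(integral_gauss (x - e)%R h0).
rewrite -[leRHS]ge0_integralZl//; last 2 first.
- by apply/measurable_EFinP/measurable_gauss; apply: measurable_funB.
- by move=> y _; rewrite lee_fin gauss_ge0.
apply: ge0_le_integral => //.
- by move=> y _; rewrite !mule_ge0// lee_fin ?gauss_ge0.
- by apply: measurable_integrand; exact/measurable_EFinP.
- apply: emeasurable_funM => //; apply/measurable_EFinP/measurable_gauss.
  by apply: measurable_funB.
move=> y _; rewrite mul0r subr0 -!EFinM lee_fin indicE mem_setE in_itv/=.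
have [yc|yc] := leP y (c - e)%R; last by rewrite mul0r mulr_ge0 ?expR_ge0 ?gauss_ge0.
rewrite mul1r !gaussE// mulrCA ler_wpM2l ?invr_ge0 ?sqrtr_ge0//.
rewrite -expRD ler_expR -!mulNr -mulrDl ler_pM2r ?invr_gt0 ?mulr_gt0//.
by nra.
Qed.

End heat.

(** * The chain killed at the grid times *)

Section killed_chain.
Context (R : realType).
Local Open Scope ereal_scope.
Implicit Types (g f : R -> \bar R) (mu h c x y : R).

Definition kill c g : R -> \bar R := g \_ `]c, +oo[.

Definition killed mu h c (n : nat) f : R -> \bar R :=
  iter n (fun g => heat mu h (kill c g)) f.

Lemma killedS mu h c n f :
  killed mu h c n.+1 f = heat mu h (kill c (killed mu h c n f)).
Proof. by []. Qed.

Lemma killE c g y : kill c g y = if (c < y)%R then g y else 0.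
Proof. by rewrite /kill patchE mem_setE in_itv/= andbT. Qed.

Lemma kill_mul c (a g : R -> \bar R) y :
  a y * kill c g y = kill c (fun z => a z * g z) y.
Proof. by rewrite !killE; case: ifP; rewrite ?mule0. Qed.

Lemma kill_ge0 c g : (forall y, 0 <= g y) -> forall y, 0 <= kill c g y.
Proof. by move=> g0 y; rewrite killE; case: ifP. Qed.

Lemma measurable_kill c g : measurable_fun setT g -> measurable_fun setT (kill c g).
Proof.
move=> mg; apply/(measurable_restrictT _ _).1 => //.
exact: measurable_funTS.
Qed.

Lemma killed_ge0 mu h c n f : (forall y, 0 <= f y) ->
  forall y, 0 <= killed mu h c n f y.
Proof.
move=> f0; elim: n => [//|n IH] y; rewrite killedS.
by apply: heat_ge0; exact: kill_ge0.
Qed.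

Lemma measurable_killed mu h c n f : measurable_fun setT f ->
  (forall y, 0 <= f y) -> measurable_fun setT (killed mu h c n f).
Proof.
move=> mf f0; elim: n => [//|n IH]; rewrite killedS.
apply: measurable_heat; first exact: measurable_kill.
by apply: kill_ge0 => y; exact: killed_ge0.
Qed.

(** The change of drift survives killing, because the tilts of successive steps
    telescope. *)
Lemma killed_drift mu h c n f x : (0 < h)%R -> measurable_fun setT f ->
  (forall y, 0 <= f y) ->
  killed mu h c n f x = (expR (- (mu * x) - mu ^+ 2 * (n%:R * h) / 2))%:E *
    killed 0 h c n (fun y => (expR (mu * y))%:E * f y) x.
Proof.
move=> h0 mf f0; pose ef y := (expR (mu * y))%:E * f y.
have mE : measurable_fun setT (fun y => (expR (mu * y))%:E).
  by apply/measurable_EFinP/measurableT_comp => //; exact: measurable_funM.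
have mef : measurable_fun setT ef by exact: emeasurable_funM.
have ef0 y : 0 <= ef y by rewrite mule_ge0// lee_fin expR_ge0.
elim: n x => [|n IH] x.
  rewrite /= muleA -EFinM -expRD.
  by rewrite (_ : _ + _ = 0)%R ?expR0 ?mul1e//; ring.
rewrite 2!killedS heat_drift//; last 2 first.
- by apply: measurable_kill; exact: measurable_killed.
- by apply: kill_ge0 => y; exact: killed_ge0.
rewrite (_ : (fun y => _) = (fun y => (expR (- (mu ^+ 2 * (n%:R * h) / 2)))%:E *
    kill c (killed 0 h c n ef) y)); last first.
  apply/funext => y.
  apply: etrans (kill_mul c (fun y => (expR (mu * y))%:E) _ y) _.
  apply: etrans (esym (kill_mul c (cst _) _ y)).
  apply: (congr1 (fun g => kill c g y)); apply/funext => z.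
  rewrite IH muleA -EFinM -expRD; congr ((expR _)%:E * _); ring.
rewrite heatZ ?expR_ge0//; last 2 first.
- by apply: measurable_kill; exact: measurable_killed.
- by apply: kill_ge0 => y; exact: killed_ge0.
rewrite muleA -EFinM -expRD -natr1; congr ((expR _)%:E * _); ring.
Qed.

Variables (h c : R) (f : R -> \bar R).
Hypotheses (h0 : (0 < h)%R) (mf : measurable_fun setT f) (f0 : forall y, 0 <= f y).
Hypothesis fc : forall y, (y <= c)%R -> f y = 0.

Let kill_f : kill c f = f.
Proof. by apply/funext => y; rewrite killE; case: ltP => // /fc ->. Qed.

Let mfr a : measurable_fun setT (fun y => f (a - y)%R).
Proof. by apply: measurableT_comp => //; exact: measurable_funB. Qed.

Let nh n : (0 < n.+1%:R * h)%R. Proof. by rewrite mulr_gt0. Qed.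

Let nhS n : (n.+2%:R * h = h + n.+1%:R * h)%R.
Proof. by rewrite -[n.+2%:R]natr1; ring. Qed.

(** By the images, [heat f - heat (f o reflection)] is the flow killed
    continuously at [c]. Looking only at grid times kills less. Formally, the
    difference is nonpositive below [c], so discarding its values there, which is
    what one killed step does, can only increase it. *)
Lemma killed_lower n x : heat 0 (n.+1%:R * h) f x <=
  killed 0 h c n.+1 f x + heat 0 (n.+1%:R * h) (fun y => f (2 * c - y)%R) x.
Proof.
elim: n x => [|n IH] x.
  by rewrite mul1r /= kill_f leeDl// heat_ge0.
rewrite nhS -heat_heat// -[X in _ <= _ + X]heat_heat// (killedS _ _ _ n.+1).
have mk : measurable_fun setT (kill c (killed 0 h c n.+1 f)).
  by apply: measurable_kill; exact: measurable_killed.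
have k0 y : 0 <= kill c (killed 0 h c n.+1 f) y.
  by apply: kill_ge0 => z; exact: killed_ge0.
have mhr : measurable_fun setT (heat 0 (n.+1%:R * h) (fun y => f (2 * c - y)%R)).
  exact: measurable_heat.
have hr0 y : 0 <= heat 0 (n.+1%:R * h) (fun y => f (2 * c - y)%R) y.
  exact: heat_ge0.
rewrite -heatD//; apply: le_heat => //.
- exact: measurable_heat.
- by move=> y; exact: heat_ge0.
- exact: emeasurable_funD.
move=> y; rewrite killE; case: ltP => [_|yc]; first exact: IH.
by rewrite add0e heat_le_reflection.
Qed.

Variables (C e : R).
Hypotheses (C0 : (0 <= C)%R) (fC : forall y, f y <= C%:E) (e0 : (0 < e)%R).
Let p := expR (- (e ^+ 2 / (2 * h))).

Let tail : R -> \bar R := fun y => C%:E * (\1_`]-oo, (c - e)%R] y)%:E.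

Let m1 : measurable_fun setT (fun y => (\1_`]-oo, (c - e)%R] y)%:E : \bar R).
Proof. exact/measurable_EFinP. Qed.

Let mtail : measurable_fun setT tail.
Proof. exact: emeasurable_funM. Qed.

Let tail0 y : 0 <= tail y.
Proof. by rewrite mule_ge0 ?lee_fin. Qed.

Let tail1 y : (y <= c - e)%R -> tail y = C%:E.
Proof. by move=> yce; rewrite /tail indicE mem_setE in_itv/= yce mule1. Qed.

Let heat_tailC x : (c < x)%R -> heat 0 h tail x <= (C * p)%:E.
Proof.
move=> cx; rewrite /tail heatZ//.
by rewrite EFinM lee_wpmul2l ?lee_fin ?heat_tail.
Qed.

(** Between [c - e] and [c] the image solution for the lowered barrier is
    nonnegative, so killing there only helps; below [c - e] it is at least
    [- C], and to get there from above [c] takes a jump of size at least [e].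
    Each step costs at most [C] times the probability of such a jump, whence the
    linear error term. *)
Lemma killed_upper n x : (c < x)%R -> killed 0 h c n.+1 f x +
    heat 0 (n.+1%:R * h) (fun y => f (2 * (c - e) - y)%R) x <=
  heat 0 (n.+1%:R * h) f x + (n.+1%:R * (C * p))%:E.
Proof.
elim: n x => [|n IH] x cx.
  rewrite !mul1r /= kill_f leeD2l//; apply: le_trans (heat_tailC cx).
  apply: le_heat => // y; have [yce|yce] := leP y (c - e)%R; first by rewrite tail1.
  by rewrite fc ?tail0//; have := e0; lra.
rewrite nhS -heat_heat// -[X in _ <= X + _]heat_heat// (killedS _ _ _ n.+1).
set q := (n.+1%:R * (C * p))%R.
have q0 : (0 <= q)%R by rewrite !mulr_ge0// expR_ge0.
have mk : measurable_fun setT (kill c (killed 0 h c n.+1 f)).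
  by apply: measurable_kill; exact: measurable_killed.
have k0 y : 0 <= kill c (killed 0 h c n.+1 f) y.
  by apply: kill_ge0 => z; exact: killed_ge0.
pose fr y := f (2 * (c - e) - y)%R.
have mhr : measurable_fun setT (heat 0 (n.+1%:R * h) fr).
  by apply: measurable_heat => [|z]; [exact: mfr|exact: f0].
have hr0 y : 0 <= heat 0 (n.+1%:R * h) fr y by apply: heat_ge0 => z; exact: f0.
have mhf : measurable_fun setT (heat 0 (n.+1%:R * h) f) by exact: measurable_heat.
have hf0 y : 0 <= heat 0 (n.+1%:R * h) f y by exact: heat_ge0.
have mq : measurable_fun setT (cst q%:E : R -> \bar R) by exact: measurable_cst.
have mqt : measurable_fun setT (fun y => cst q%:E y + tail y).
  exact: emeasurable_funD.
have qt0 y : 0 <= cst q%:E y + tail y by rewrite adde_ge0.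
rewrite -heatD//.
apply: (@le_trans _ _ (heat 0 h (fun y => heat 0 (n.+1%:R * h) f y +
    (cst q%:E y + tail y)) x)).
  apply: le_heat => //.
  - exact: emeasurable_funD.
  - by move=> y; rewrite adde_ge0.
  - exact: emeasurable_funD.
  move=> y; rewrite killE; have [cy|yc] := ltP c y.
    by apply: (le_trans (IH _ cy)); rewrite [leRHS]addeA leeDl.
  rewrite add0e; have [yce|cey] := leP y (c - e)%R; last first.
    rewrite (@le_trans _ _ (heat 0 (n.+1%:R * h) f y)) ?leeDl//.
    apply: heat_ge_reflection => // [z zc|]; last exact: ltW.
    by apply: fc; have := e0; lra.
  rewrite tail1// (@le_trans _ _ C%:E)//.
    rewrite -(heat_cst y (nh n) C0); apply: le_heat => //.
  by rewrite [leRHS]addeA leeDr// adde_ge0// lee_fin.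
rewrite heatD// leeD2l// heatD// heat_cst//.
rewrite (_ : (n.+2%:R * (C * p) = q + C * p)%R); last by rewrite -natr1 /q; ring.
by rewrite EFinD leeD2l// heat_tailC.
Qed.

End killed_chain.

(** * Independence and iterated integrals *)

Section restriction.
Context d (T : measurableType d) (R : realType) (P : probability T R).
Local Open Scope ereal_scope.

Lemma ge0_integral_restriction (E : set T) (mE : measurable E) (f : T -> \bar R) :
  measurable_fun setT f -> (forall x, 0 <= f x) ->
  \int[mrestr P mE]_x f x = \int[P]_(x in E) f x.
Proof.
move=> mf f0; rewrite (@ge0_integral_density _ _ _ _ P (\1_E))//.
- by rewrite [RHS]integral_mkcond epatch_indic.
- by move=> A mA; rewrite integral_indic// setIC.
Qed.
End restriction.

Section independence.
Context d (T : measurableType d) (R : realType) (P : probability T R).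
Context d1 (U : measurableType d1) d2 (V : measurableType d2).
Variables (N : probability V R) (E : set T) (S : T -> U) (X : T -> V).
Hypotheses (mE : measurable E) (mS : measurable_fun setT S).
Hypothesis mX : measurable_fun setT X.
Hypothesis indep : forall (A : set U) (B : set V), measurable A -> measurable B ->
  (P (E `&` S @^-1` A `&` X @^-1` B) = P (E `&` S @^-1` A) * N B)%E.
Local Open Scope ereal_scope.

Let SX : T -> U * V := fun x => (S x, X x).

Let mSX : measurable_fun setT SX.
Proof. exact: measurable_fun_pair. Qed.

Let m1 := pushforward (mrestr P mE) S.

HB.instance Definition _ := Measure.copy m1
  (measure_function_pushforward__canonical__measure_function_Measure (mrestr P mE) mS).

Let m1_fin : fin_num_fun m1.
Proof. by move=> A mA; apply: fin_num_measure; rewrite -[X in measurable X]setTI; exact: mS. Qed.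

HB.instance Definition _ := @Measure_isFinite.Build _ _ _ m1 m1_fin.

Let m12 := pushforward (mrestr P mE) SX.

HB.instance Definition _ := Measure.copy m12
  (measure_function_pushforward__canonical__measure_function_Measure (mrestr P mE) mSX).

Let m12E A : measurable A -> m12 A = (m1 \x N) A.
Proof.
move=> mA; apply/esym; apply: product_measure_unique => // B C mB mC.
transitivity (P (E `&` S @^-1` B `&` X @^-1` C)).
  by congr (P _); apply/seteqP; split => x /= => [[[? ?] ?]|[[? ?] ?]].
by rewrite indep//; congr (_ * _); congr (P _); rewrite setIC.
Qed.

(** Independence of [X] from the pair ([E], [S]) identifies the joint law of
    ([S], [X]) on [E] with a product measure, and Tonelli integrates [X] out. *)
Lemma ge0_integral_indep (f : U * V -> \bar R) : measurable_fun setT f ->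
  (forall z, 0 <= f z) ->
  \int[P]_(x in E) f (S x, X x) = \int[P]_(x in E) \int[N]_y f (S x, y).
Proof.
move=> mf f0.
have mF : measurable_fun setT (fun s => \int[N]_y f (s, y)).
  exact: (@measurable_fun_fubini_tonelli_F _ _ _ _ _ N f).
have F0 s : 0 <= \int[N]_y f (s, y) by exact: integral_ge0.
rewrite -!ge0_integral_restriction//; last 2 first.
- exact: (measurableT_comp mF mS).
- exact: (measurableT_comp mf mSX).
transitivity (\int[m12]_z f z).
  by rewrite ge0_integral_pushforward.
transitivity (\int[m1 \x N]_z f z).
  by apply: eq_measure_integral => A mA _; exact: m12E.
rewrite fubini_tonelli1//= /fubini_F.
by rewrite ge0_integral_pushforward.
Qed.

End independence.

(** * The heat operator as an average over a normal step *)

Section translation.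
Context (R : realType).
Local Notation leb := (@lebesgue_measure R).
Local Open Scope ereal_scope.

Lemma ge0_integral_translation (a : R) (f : R -> \bar R) :
  measurable_fun setT f -> (forall x, 0 <= f x) ->
  \int[leb]_y f (a + y)%R = \int[leb]_y f y.
Proof.
move=> mf f0; rewrite -(ge0_integral_reflection a mf)//.
rewrite -[RHS](ge0_integral_reflection 0); last 2 first.
- by apply: measurableT_comp => //; exact: measurable_funB.
- by [].
by apply: eq_integral => y _; congr f; ring.
Qed.

Lemma heat_normal (mu h : R) (g : R -> \bar R) (x : R) : (0 < h)%R ->
  measurable_fun setT g -> (forall y, 0 <= g y) ->
  \int[normal_prob 0 (Num.sqrt h)]_z g (x + mu * h + z)%R = heat mu h g x.
Proof.
move=> h0 mg g0.
have mga : measurable_fun setT (fun z => g (x + mu * h + z)%R).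
  by apply: measurableT_comp => //; exact: measurable_funD.
have mgh : measurable_fun setT (gauss h) by exact: measurable_gauss.
have NE A : measurable A -> normal_prob 0 (Num.sqrt h) A =
    \int[leb]_(z in A) (gauss h z)%:E by [].
apply: etrans (@ge0_integral_density _ _ _ (normal_prob 0 (Num.sqrt h)) leb
  (gauss h) mgh (gauss_ge0 h) NE _ mga (fun z => g0 _)) _.
rewrite /heat -[RHS](ge0_integral_translation (x + mu * h)).
- by apply: eq_integral => y _; congr (_ * (gauss _ _)%:E); ring.
- apply: emeasurable_funM => //; apply/measurable_EFinP/measurable_gauss.
  by do 2 apply: measurable_funB => //.
- by move=> y; rewrite mule_ge0// lee_fin gauss_ge0.
Qed.

End translation.

(** * Brownian motion along a grid *)

Section walk.
Context d (Omega : measurableType d) (R : realType) (P : probability Omega R).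
Context (B : brownian_motion P) (mu u c h : R) (h0 : 0 < h).

Definition increment (i : nat) (x : Omega) : R :=
  B (i.+1%:R * h) x - B (i%:R * h) x.

(** The position at time [k h], started at [u]. Subtracting [B 0], which vanishes
    almost surely, makes it a function of the increments alone, everywhere. *)
Definition walk (k : nat) (x : Omega) : R :=
  u + (B (k%:R * h) x - B 0 x) + mu * (k%:R * h).

(** Time 0 is not tested: the starting point is handled by the hypotheses on
    [u]. *)
Definition survive (k : nat) : set Omega :=
  [set x | forall j, (0 < j <= k)%N -> c < walk j x].

Lemma measurable_increment i : measurable_fun setT (increment i).
Proof. exact: measurable_funB. Qed.

Lemma measurable_walk k : measurable_fun setT (walk k).
Proof. by do 2 apply: measurable_funD => //; exact: measurable_funB. Qed.

Lemma walkS k x : walk k.+1 x = walk k x + mu * h + increment k x.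
Proof. by rewrite /walk /increment -natr1; ring. Qed.

Lemma walk0 x : walk 0 x = u.
Proof. by rewrite /walk !mul0r; ring. Qed.

(** The pi-system of rectangles in the first [k] increments; the independence in
    the definition of Brownian motion is about exactly these events. *)
Let past k : set (set Omega) := [set D | exists2 A : nat -> set R,
  (forall i, measurable (A i)) &
  D = [set x | forall i, (i < k)%N -> A i (increment i x)]].

Let pastI k : setI_closed (past k).
Proof.
move=> _ _ [A mA ->] [A' mA' ->]; exists (fun i => A i `&` A' i).
  by move=> i; exact: measurableI.
apply/seteqP; split=> x /=; first by move=> [H H'] i ik; split; [exact: H|exact: H'].
by move=> H; split=> i /H[].
Qed.

Let past_measurable k : past k `<=` measurable.
Proof.
move=> _ [A mA ->].
rewrite (_ : [set _ | _] = \bigcap_(i in `I_k) increment i @^-1` A i)//.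
apply: bigcap_measurableType => i _; rewrite -[X in measurable X]setTI.
exact: measurable_increment.
Qed.

Let pastT k : past k [set: Omega].
Proof. by exists (fun=> setT) => //; apply/seteqP; split. Qed.

Let increment_in_past k i : (i < k)%N -> measurable_fun setT
  (increment i : g_sigma_algebraType (past k) -> R).
Proof.
move=> ik _ Y mY; rewrite setTI; apply: sub_sigma_algebra.
exists (fun j => if j == i then Y else setT).
  by move=> j; case: ifP.
apply/seteqP; split=> x /=; last by move=> /(_ _ ik); rewrite eqxx.
by move=> Yx j jk; case: eqP => // ->.
Qed.

Let walk_in_past k j : (j <= k)%N -> measurable_fun setT
  (walk j : g_sigma_algebraType (past k) -> R).
Proof.
elim: j => [_|j IH jk].
  by rewrite (_ : walk 0 = cst u)//; apply/funext => x; rewrite walk0.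
rewrite (_ : walk j.+1 = fun x => walk j x + mu * h + increment j x); last first.
  by apply/funext => x; rewrite walkS.
apply: measurable_funD; last exact: increment_in_past.
by apply: measurable_funD => //; apply: IH; exact: ltnW.
Qed.

Let surviveE k : survive k =
  \bigcap_(j in [set j | (0 < j <= k)%N]) walk j @^-1` `]c, +oo[.
Proof.
by apply/seteqP; split=> x H j /H; rewrite /= in_itv/= andbT.
Qed.

Let survive_in_past k (A : set R) : measurable A ->
  <<s past k >> (survive k `&` walk k @^-1` A).
Proof.
move=> mA; apply: (@measurableI _ (g_sigma_algebraType (past k))).
  rewrite surviveE; apply: bigcap_measurableType => j /= /andP[_ jk].
  by rewrite -[X in measurable X]setTI; exact: walk_in_past.
by rewrite -[X in measurable X]setTI; exact: walk_in_past.
Qed.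

(** Dynkin: independence of the next increment passes from rectangles to the
    sigma-algebra they generate, which contains the survival event and the
    current position. *)
Let past_indep k (A : set R) D : measurable A -> <<s past k >> D ->
  measurable D /\
  (P (D `&` increment k @^-1` A) = P D * normal_prob 0 (Num.sqrt h) A)%E.
Proof.
move=> mA; set N := normal_prob _ _ _.
have mX : measurable (increment k @^-1` A).
  by rewrite -[X in measurable X]setTI; exact: measurable_increment.
have PX : P (increment k @^-1` A) = N.
  rewrite /N -[in RHS](_ : k.+1%:R * h - k%:R * h = h); last first.
    by rewrite -natr1; ring.
  apply: (@bm_normal _ _ _ _ B) => //.
  apply/andP; split; first by rewrite mulr_ge0// ltW.
  by rewrite ltr_pM2r// ltr_nat.
have N0 : N \is a fin_num by rewrite -PX fin_num_measure.
have ih0 : 0 <= 0%:R * h by rewrite mul0r.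
have ihh : {homo (fun i : nat => i%:R * h) : i j / (i <= j)%N >-> i <= j}.
  by move=> i j ij; rewrite ler_pM2r// ler_nat.
pose indep (D : set Omega) := measurable D /\
  (P (D `&` increment k @^-1` A) = P D * N)%E.
have indepC (D' : set Omega) : indep D' -> indep (~` D').
  move=> [mD' PD']; split; first exact: measurableC.
  transitivity (P (increment k @^-1` A) - P (D' `&` increment k @^-1` A))%E.
    by rewrite setIC -setDE measureD ?(setIC _ D')// ltey_eq fin_num_measure.
  rewrite PD' PX probability_setC// muleBl//.
  by rewrite mul1e.
have indepU (F : (set Omega)^nat) : trivIset setT F -> (forall n, indep (F n)) ->
    indep (\bigcup_n F n).
  move=> tF FP; have mF i : measurable (F i) by case: (FP i).
  split; first exact: bigcup_measurable.
  rewrite setI_bigcupl !measure_bigcup//.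
  - rewrite -[in RHS](fineK N0) muleC -nneseriesZl//.
    by apply: eq_eseriesr => n _; rewrite fineK// muleC; exact: (FP n).2.
  - by move=> i _; exact: measurableI.
  - exact: trivIset_setIr.
apply: (@dynkin_induction _ (g_sigma_algebraType (past k)) (past k)
  indep) => //.
- by split=> //; rewrite setTI probability_setT mul1e.
- move=> {}D [A' mA' DE]; split; first by apply: (past_measurable (k := k)); exists A'.
  (* The rectangle in one more increment, with [A] as its last side. *)
  pose A2 i := if i == k then A else A' i.
  have mA2 i : measurable (A2 i) by rewrite /A2; case: ifP.
  have := @bm_independent _ _ _ _ B k.+1 _ A2 ih0 ihh mA2.
  have A2k : A2 k = A by rewrite /A2 eqxx.
  rewrite big_ord_recr/= A2k => H.
  have H' := @bm_independent _ _ _ _ B k _ A' ih0 ihh mA'.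
  have PD : P D = (\prod_(i < k) P [set x | A2 i (increment i x)])%E.
    rewrite DE [LHS]H'; apply: eq_bigr => i _; congr (P _).
    by rewrite /A2 ltn_eqF.
  rewrite PD -PX.
  rewrite -[RHS]H; congr (P _); apply/seteqP; split => x /=.
    rewrite DE => -[H1 H2] i; rewrite ltnS leq_eqVlt => /orP[/eqP ->|ik].
      by rewrite /A2 eqxx.
    by rewrite /A2 ltn_eqF//; exact: H1.
  move=> H1; rewrite DE; split=> [i ik|].
    by have := H1 i (ltnW ik); rewrite /A2 ltn_eqF.
  by have := H1 k (leqnn _); rewrite /A2 eqxx.
- by move=> D' _; exact: indepC.
- by move=> F _; exact: indepU.
Qed.

Lemma measurable_survive k : measurable (survive k).
Proof.
have := survive_in_past (k := k) measurableT; rewrite preimage_setT setIT.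
by move=> /(past_indep measurableT)[].
Qed.

Local Open Scope ereal_scope.

Let survive_step k (g : R -> \bar R) : measurable_fun setT g ->
  (forall y, 0 <= g y) ->
  \int[P]_(x in survive k.+1) g (walk k.+1 x) =
  \int[P]_(x in survive k) heat mu h (kill c g) (walk k x).
Proof.
move=> mg g0.
have mk : measurable_fun setT (kill c g) by exact: measurable_kill.
have k0 y : 0 <= kill c g y by exact: kill_ge0.
pose F (z : R * R) := kill c g (z.1 + mu * h + z.2)%R.
have mF : measurable_fun setT F.
  by apply: measurableT_comp => //; do 2 apply: measurable_funD => //.
have -> : survive k.+1 = survive k `&` walk k.+1 @^-1` `]c, +oo[.
  apply/seteqP; split => x /=; rewrite in_itv/= andbT.
    move=> H; split; last by apply: H; rewrite ltnSn.
    by move=> j /andP[j0 jk]; apply: H; rewrite j0 ltnW.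
  move=> [H Hk] j /andP[j0]; rewrite leq_eqVlt => /orP[/eqP -> //|jk].
  by apply: H; rewrite j0.
transitivity (\int[P]_(x in survive k) F (walk k x, increment k x)).
  rewrite integral_mkcondr; apply: eq_integral => x _.
  rewrite /F/= -walkS killE patchE; case: ltP => cw.
    by rewrite mem_set//= in_itv/= andbT.
  by rewrite memNset//= in_itv/= andbT; apply/negP; rewrite -leNgt.
rewrite (@ge0_integral_indep _ _ _ _ _ _ _ _ (normal_prob 0 (Num.sqrt h)))//.
- by apply: eq_integral => x _; exact: heat_normal.
- exact: measurable_survive.
- exact: measurable_walk.
- exact: measurable_increment.
- by move=> A A' mA mA'; exact: (past_indep mA' (survive_in_past mA)).2.
- by move=> z; exact: k0.
Qed.

(** The Markov property, applied at one grid time after the other. *)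
Lemma walk_killed n (f : R -> \bar R) : measurable_fun setT f ->
  (forall y, 0 <= f y) ->
  \int[P]_(x in survive n) f (walk n x) = killed mu h c n f u.
Proof.
elim: n f => [|n IH] f mf f0.
  rewrite (_ : survive 0 = setT); last first.
    by apply/seteqP; split => // x _ [].
  under eq_integral do rewrite walk0.
  rewrite integral_cst// -[RHS]mule1; congr (_ * _); exact: probability_setT.
rewrite survive_step// IH.
- by rewrite /killed iterSr.
- by apply: measurable_heat; [exact: measurable_kill|exact: kill_ge0].
- by move=> y; apply: heat_ge0; exact: kill_ge0.
Qed.

End walk.

(** * From the grid to the minimum of the path *)

Section comparison.
Context d (Omega : measurableType d) (R : realType) (P : probability Omega R).
Context (B : brownian_motion P) (mu u v t : R) (t0 : 0 < t).
Local Notation path := (drift_path B mu t u).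

Definition stay : set Omega := [set x | v < inf (range (path x))].

Definition final (x : Omega) : R := path x (endpoint t0).

Lemma measurable_stay : measurable stay.
Proof.
have := @measurable_drift_path _ _ _ _ B mu t u measurableT _
  (@measurable_inf_gt R t v).
by rewrite setTI.
Qed.

Lemma finalE x : final x = u + (B t x + mu * t).
Proof. by []. Qed.

Lemma measurable_final : measurable_fun setT final.
Proof.
rewrite (_ : final = fun x => u + (B t x + mu * t))//.
by apply: measurable_funD => //; apply: measurable_funD.
Qed.

Lemma has_lbound_cpath (w : cpath t) : has_lbound (range w).
Proof.
have [c ct cP] := EVT_min (ltW t0) (@cpath_within _ _ w).
exists (valL_ 0 w c) => _ [s _ <-]; rewrite -cpath_valL.
by apply: cP; have := set_valP s.
Qed.

Lemma inf_le_cpath (w : cpath t) s : inf (range w) <= w s.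
Proof. by apply: ge_inf; [exact: has_lbound_cpath|exists s]. Qed.

Lemma stay_final x : stay x -> v < final x.
Proof. by move=> vx; apply: lt_le_trans vx _; exact: inf_le_cpath. Qed.

Section grid.
Variables (n : nat) (c : R).
Let h : R := t / n.+1%:R.

Let h0 : 0 < h. Proof. by rewrite divr_gt0. Qed.

Let nhE : n.+1%:R * h = t. Proof. by rewrite /h mulrC divfK. Qed.

Let grid_in k : (k <= n.+1)%N -> k%:R * h \in `[0, t]%classic.
Proof.
move=> kn; rewrite inE/= in_itv/=; apply/andP; split; first by rewrite mulr_ge0// ltW.
by rewrite -[leRHS]nhE ler_pM2r// ler_nat.
Qed.

Let grid k (kn : (k <= n.+1)%N) : set_type `[0, t]%classic :=
  exist (fun x : R => x \in `[0, t]%classic) (k%:R * h) (grid_in kn).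

Lemma walk_path x k (kn : (k <= n.+1)%N) : B 0 x = 0 ->
  walk B mu u h k x = path x (grid kn).
Proof. by move=> B0; rewrite /walk B0 subr0 -addrA. Qed.

Lemma walk_final x : B 0 x = 0 -> walk B mu u h n.+1 x = final x.
Proof.
move=> B0; rewrite (walk_path (leqnn _))// finalE.
by rewrite -[in RHS]nhE.
Qed.

Lemma stay_survive x : B 0 x = 0 -> stay x -> survive B mu u v h n.+1 x.
Proof.
move=> B0 sx j /andP[_ jn]; rewrite (walk_path jn)//.
by apply: lt_le_trans sx _; exact: inf_le_cpath.
Qed.

(** Any time of [0, t] is within one mesh of a grid time, where a surviving path
    is above [c]. *)
Lemma survive_path_close x (s : set_type `[0, t]%classic) : B 0 x = 0 -> c < u ->
  survive B mu u c h n.+1 x ->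
  exists2 s', `|set_val s - set_val s'| < h & c < path x s'.
Proof.
move=> B0 cu sx; have := set_valP s; rewrite /= in_itv/=.
have -> : \val s = set_val s by []; move=> /andP[s_ge0 st].
(* The last grid time before [s]. *)
set k := Num.truncn (set_val s / h).
have /andP[k1 k2] : (k%:R <= set_val s / h) && (set_val s / h < k.+1%:R).
  by apply: truncn_itv; rewrite divr_ge0// ltW.
have kn : (k <= n.+1)%N.
  by rewrite -(ler_nat R) (le_trans k1)// ler_pdivrMr// nhE.
exists (grid kn).
  rewrite set_valE/= ger0_norm; last by rewrite subr_ge0 -ler_pdivlMr.
  by rewrite ltrBlDr -[X in X + _]mul1r -mulrDl addrC natr1 -ltr_pdivrMr.
rewrite -(walk_path kn)//; have [k_eq0|k0] := posnP k; last by apply: sx; rewrite k0.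
by rewrite k_eq0 walk0.
Qed.

End grid.
End comparison.

Section discretization.
Context d (Omega : measurableType d) (R : realType) (P : probability Omega R).
Context (B : brownian_motion P) (mu u v t : R) (t0 : 0 < t).
Local Notation path := (drift_path B mu t u).
Local Notation step n := (t / n.+1%:R).

(** A path whose minimum is at most [v] comes below [(v + c) / 2]; by uniform
    continuity it is below [c] at a neighbouring grid time once the mesh is
    fine. *)
Lemma survive_stay_eventually c x : v < c -> c < u -> B 0 x = 0 ->
  ~ stay B mu u v t x ->
  \forall n \near \oo, ~ survive B mu u c (step n) n.+1 x.
Proof.
move=> vc cu B0 /negP; rewrite -leNgt => infv.
have e0 : 0 < (c - v) / 2 by lra.
have [_ [s _ <-] ws] : exists2 y, range (path x) y & y < (v + c) / 2.
  by apply: inf_lt; [exists (path x (endpoint t0)); exists (endpoint t0)|lra].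
have [m mP] := cpath_unif (path x) e0.
have m0 : 0 < m.+1%:R^-1 / t :> R by rewrite divr_gt0.
have := near_infty_natSinv_lt (PosNum m0); apply: filterS => n /= nm sx.
have [s' ss' cs'] := survive_path_close t0 s B0 cu sx.
have /mP : `|set_val s - set_val s'| < m.+1%:R^-1.
  by apply: lt_trans ss' _; rewrite mulrC -ltr_pdivlMr.
by rewrite ltr_distl => /andP[]; lra.
Qed.

Lemma survive_stay_cvg c : v < c -> c < u ->
  P (survive B mu u c (step n) n.+1 `\` stay B mu u v t) @[n --> \oo] --> 0%E.
Proof.
move=> vc cu; pose F n := survive B mu u c (step n) n.+1 `\` stay B mu u v t.
have mF n : measurable (F n).
  apply: measurableD; last exact: measurable_stay.
  by apply: measurable_survive; rewrite divr_gt0.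
have mI n : measurable_fun setT (fun x => (\1_(F n) x)%:E : \bar R).
  exact/measurable_EFinP/measurable_indic.
have -> : (fun n => P (F n)) = (fun n => \int[P]_x (\1_(F n) x)%:E)%E.
  by apply/funext => n; rewrite integral_indic// setIT.
have -> : (0 = \int[P]_x (cst 0 x))%E by rewrite integral0.
have [] // := @dominated_convergence _ _ _ P setT measurableT
  (fun n x => (\1_(F n) x)%:E) (cst 0%E) (cst 1%E) mI (measurable_cst _).
- apply: filterS (bm_start B) => x B0 _; apply: cvg_near_cst.
  have [sx|sx] := pselect (stay B mu u v t x).
    by apply: nearW => n; rewrite indicE memNset// => -[].
  have := survive_stay_eventually vc cu B0 sx.
  by apply: filterS => n nx; rewrite indicE memNset// => -[].
- exact: finite_measure_integrable_cst.
- by apply: nearW => x n _ /=; rewrite lee_fin ger0_norm.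
Qed.

End discretization.

Section sandwich.
Context d (Omega : measurableType d) (R : realType) (P : probability Omega R).
Context (B : brownian_motion P) (mu u v t : R) (t0 : 0 < t).
Variable f : R -> \bar R.
Local Notation step n := (t / n.+1%:R).
Local Open Scope ereal_scope.
Hypotheses (mf : measurable_fun setT f) (f0 : forall y, 0 <= f y).

Definition exp_tilt (y : R) : \bar R := (expR (mu * y))%:E * f y.

(** The part of the exponential martingale that does not involve the endpoint. *)
Definition drift_weight : R := expR (- (mu * u) - mu ^+ 2 * t / 2).

Local Notation W := (drift_weight)%:E.

Let W0 : 0 <= W. Proof. by rewrite lee_fin expR_ge0. Qed.

Lemma measurable_exp_tilt : measurable_fun setT exp_tilt.
Proof.
apply: emeasurable_funM => //.
by apply/measurable_EFinP/measurableT_comp => //; exact: measurable_funM.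
Qed.

Lemma exp_tilt_ge0 y : 0 <= exp_tilt y.
Proof. by rewrite mule_ge0// lee_fin expR_ge0. Qed.

Let step0 n : (0 < step n)%R. Proof. by rewrite divr_gt0. Qed.

Let stepE n : (n.+1%:R * step n = t)%R. Proof. by rewrite mulrC divfK. Qed.

Let walk_killed0 c n :
  \int[P]_(x in survive B mu u c (step n) n.+1) f (walk B mu u (step n) n.+1 x) =
  W * killed 0 (step n) c n.+1 exp_tilt u.
Proof. by rewrite walk_killed// killed_drift// stepE. Qed.

(** The accumulated error [N C exp (- q N)] of [N] grid steps, where
    [q = e ^+ 2 / (2 t)], is at most [4 C / (q ^+ 2 N)]. *)
Let exp_small (C e : R) (eps : R) : (0 <= C)%R -> (0 < e)%R -> (0 < eps)%R ->
  exists n, (n.+1%:R * (C * expR (- (e ^+ 2 / (2 * step n)))) <= eps)%R.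
Proof.
move=> C0 e0 eps0; pose q := (e ^+ 2 / (2 * t))%R.
have q0 : (0 < q)%R by rewrite divr_gt0 ?exprn_gt0// mulr_gt0.
have k0 : (0 < 4 * C / (q ^+ 2 * eps) + 1)%R.
  rewrite ltr_wpDl//; apply: divr_ge0; first exact: mulr_ge0.
  by rewrite ltW// mulr_gt0// exprn_gt0.
set k := (_ + 1)%R in k0.
have [n kn] : exists n, (k <= n.+1%:R)%R.
  exists (Num.truncn k); apply: ltW; have := truncn_itv (ltW k0).
  by case/andP.
exists n; rewrite (_ : e ^+ 2 / (2 * step n) = q * n.+1%:R)%R; last first.
  by rewrite /q; field; rewrite gt_eqF//= pnatr_eq0.
move: (n.+1%:R : R) kn => m km.
have m0 : (0 < m)%R by exact: lt_le_trans km.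
have qm0 : (0 < q * m)%R by rewrite mulr_gt0.
have lb : ((q * m) ^+ 2 / 4 <= expR (q * m))%R.
  rewrite (_ : expR (q * m) = expR (q * m / 2) ^+ 2)%R; last first.
    by rewrite -expRM_natl; congr expR; field.
  rewrite (_ : _ / 4 = (q * m / 2) ^+ 2)%R; last by field.
  have qm2 : (0 <= q * m / 2)%R by rewrite divr_ge0// ltW.
  rewrite ler_pXn2r ?nnegrE ?expR_ge0//.
  by apply: le_trans (expR_ge1Dx _); rewrite lerDr.
rewrite expRN mulrA ler_pdivrMr ?expR_gt0//.
apply: (@le_trans _ _ (eps * ((q * m) ^+ 2 / 4)))%R; last by rewrite ler_pM2l.
have : (4 * C <= m * (q ^+ 2 * eps))%R.
  have q2e : (0 < q ^+ 2 * eps)%R by rewrite mulr_gt0// exprn_gt0.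
  by rewrite -ler_pdivrMr//; apply: le_trans km; rewrite lerDl.
move=> H; have : (m * (4 * C) <= m * (m * (q ^+ 2 * eps)))%R.
  by rewrite ler_pM2l.
by rewrite [((q * m) ^+ 2)%R]exprMn; lra.
Qed.

Let le_eps (x y : \bar R) : (forall eps : R, (0 < eps)%R -> x <= y + eps%:E) ->
  x <= y.
Proof. by move=> H; apply/lee_addgt0Pr. Qed.

Let mstep c n : measurable (survive B mu u c (step n) n.+1).
Proof. exact: measurable_survive. Qed.

Let mfwalk n : measurable_fun setT (fun x => f (walk B mu u (step n) n.+1 x)).
Proof. by apply: measurableT_comp => //; exact: measurable_walk. Qed.

Let mffinal : measurable_fun setT (fun x => f (final B mu u t0 x)).
Proof. by apply: measurableT_comp => //; exact: measurable_final. Qed.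

(** Staying above the barrier implies surviving on every grid; the error of
    [killed_upper] vanishes as the mesh tends to 0. *)
Lemma stay_upper (C e : R) : (v < u)%R -> (0 < e)%R -> (0 <= C)%R ->
  (forall y, (y <= v)%R -> f y = 0) -> (forall y, exp_tilt y <= C%:E) ->
  \int[P]_(x in stay B mu u v t) f (final B mu u t0 x) +
    W * heat 0 t (fun y => exp_tilt (2 * (v - e) - y)%R) u <=
  W * heat 0 t exp_tilt u.
Proof.
move=> vu e0 C0 fv fC; apply: le_eps => eps eps0.
have W1 : (0 < drift_weight)%R by rewrite expR_gt0.
have [n nP] := exp_small C0 e0 (divr_gt0 eps0 W1).
have le_walk : \int[P]_(x in stay B mu u v t) f (final B mu u t0 x) <=
    W * killed 0 (step n) v n.+1 exp_tilt u.
  rewrite -walk_killed0 integral_mkcond [leRHS]integral_mkcond.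
  apply: ae_ge0_le_integral => //.
  - by move=> x _; exact: erestrict_ge0.
  - by apply/(measurable_restrictT _ _).1; [exact: measurable_stay|exact: measurable_funTS].
  - by move=> x _; exact: erestrict_ge0.
  - by apply/(measurable_restrictT _ _).1 => //; exact: measurable_funTS.
  apply: filterS (bm_start B) => x B0 _; rewrite !patchE.
  case: ifPn => [/set_mem sx|_]; last by case: ifP.
  by rewrite mem_set; [rewrite walk_final|exact: stay_survive].
have tv y : (y <= v)%R -> exp_tilt y = 0.
  by move=> yv; rewrite /exp_tilt fv// mule0.
apply: (le_trans (leeD2r _ le_walk)).
have k0 : 0 <= killed 0 (step n) v n.+1 exp_tilt u.
  by apply: killed_ge0 => y; exact: exp_tilt_ge0.
have r0 : 0 <= heat 0 t (fun y => exp_tilt (2 * (v - e) - y)%R) u.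
  by apply: heat_ge0 => y; exact: exp_tilt_ge0.
rewrite -[leLHS](ge0_muleDr W k0 r0) -{2 3}(stepE n).
apply: (@le_trans _ _ (W * (heat 0 (n.+1%:R * step n) exp_tilt u +
    (n.+1%:R * (C * expR (- (e ^+ 2 / (2 * step n)))))%:E))).
  rewrite lee_wpmul2l//; apply: killed_upper => //.
  - exact: measurable_exp_tilt.
  - exact: exp_tilt_ge0.
have h0 : 0 <= heat 0 (n.+1%:R * step n) exp_tilt u.
  by apply: heat_ge0; exact: exp_tilt_ge0.
have err0 : 0 <= (n.+1%:R * (C * expR (- (e ^+ 2 / (2 * step n)))))%:E.
  by rewrite lee_fin !mulr_ge0// expR_ge0.
rewrite (ge0_muleDr W h0 err0).
rewrite leeD2l// -EFinM lee_fin -ler_pdivlMl// [leRHS]mulrC.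
exact: nP.
Qed.

(** A path that survives above [c > v] on fine grids stays above [v], up to an
    event of vanishing probability; [killed_lower] bounds the survival from
    below. *)
Lemma stay_lower (C c : R) : (v < c)%R -> (c < u)%R -> (0 <= C)%R ->
  (forall y, (y <= c)%R -> f y = 0) -> (forall y, f y <= C%:E) ->
  W * heat 0 t exp_tilt u <=
  \int[P]_(x in stay B mu u v t) f (final B mu u t0 x) +
    W * heat 0 t (fun y => exp_tilt (2 * c - y)%R) u.
Proof.
move=> vc cu C0 fc fC; apply: le_eps => eps eps0.
have tc y : (y <= c)%R -> exp_tilt y = 0.
  by move=> yc; rewrite /exp_tilt fc// mule0.
pose F n := survive B mu u c (step n) n.+1 `\` stay B mu u v t.
have mF n : measurable (F n).
  by apply: measurableD => //; exact: measurable_stay.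
have [n Fn] : exists n, C%:E * P (F n) <= eps%:E.
  have := survive_stay_cvg B mu t0 vc cu.
  have C1 : (0 < eps / (C + 1))%R by rewrite divr_gt0// ltr_wpDl.
  move=> /fine_cvgP[_] /cvgrPdist_lt /(_ _ C1)[n _ /(_ n (leqnn n))] /=.
  rewrite sub0r normrN ger0_norm ?fine_ge0// => PF.
  exists n; rewrite -[P (F n)]fineK ?fin_num_measure// -EFinM lee_fin.
  move: PF; rewrite ltr_pdivlMr ?ltr_wpDl// => /ltW; apply: le_trans.
  by rewrite mulrC ler_wpM2l ?fine_ge0// lerDl.
have le_walk : W * killed 0 (step n) c n.+1 exp_tilt u <=
    \int[P]_(x in stay B mu u v t) f (final B mu u t0 x) + eps%:E.
  rewrite -walk_killed0; apply: le_trans (leeD2l _ Fn).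
  have -> : C%:E * P (F n) = \int[P]_x (C%:E * (\1_(F n) x)%:E).
    rewrite ge0_integralZl//; last by exact/measurable_EFinP/measurable_indic.
    by rewrite integral_indic// setIT.
  rewrite integral_mkcond [X in X + _]integral_mkcond.
  have mst : measurable_fun setT
      ((fun x => f (final B mu u t0 x)) \_ (stay B mu u v t)).
    by apply/(measurable_restrictT _ _).1; [exact: measurable_stay|exact: measurable_funTS].
  have mC : measurable_fun setT (fun x => C%:E * (\1_(F n) x)%:E).
    by apply: emeasurable_funM => //; exact/measurable_EFinP/measurable_indic.
  rewrite -ge0_integralD//; last 2 first.
  - by move=> x _; exact: erestrict_ge0.
  - by move=> x _; rewrite mule_ge0 ?lee_fin.
  apply: ae_ge0_le_integral => //.
  - by move=> x _; exact: erestrict_ge0.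
  - by apply/(measurable_restrictT _ _).1 => //; exact: measurable_funTS.
  - by move=> x _; rewrite adde_ge0 ?mule_ge0 ?lee_fin//; exact: erestrict_ge0.
  - exact: emeasurable_funD.
  apply: filterS (bm_start B) => x B0 _; rewrite !patchE.
  case: ifPn => [/set_mem sx|_]; last first.
    by rewrite adde_ge0 ?mule_ge0 ?lee_fin//; case: ifP.
  case: ifPn => [/set_mem st|/negP nst].
    by rewrite walk_final// leeDl// mule_ge0 ?lee_fin.
  rewrite add0e indicE mem_set ?mule1//.
  by split=> // st; apply: nst; rewrite inE.
rewrite addeAC; apply: le_trans (leeD2r _ le_walk).
have k0 : 0 <= killed 0 (step n) c n.+1 exp_tilt u.
  by apply: killed_ge0 => y; exact: exp_tilt_ge0.
have r0 : 0 <= heat 0 t (fun y => exp_tilt (2 * c - y)%R) u.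
  by apply: heat_ge0 => y; exact: exp_tilt_ge0.
rewrite -(ge0_muleDr W k0 r0) lee_wpmul2l// -{1 3}(stepE n).
apply: killed_lower => //.
- exact: measurable_exp_tilt.
- exact: exp_tilt_ge0.
Qed.

End sandwich.

(** * Law of the endpoint on the event of staying above the barrier *)

Section density_split.
Context d (T : measurableType d) (R : realType) (m : {measure set T -> \bar R}).
Variables (p q : T -> R).
Hypotheses (mp : measurable_fun setT p) (mq : measurable_fun setT q).
Hypotheses (q0 : forall y, 0 <= q y) (qp : forall y, q y <= p y).
Local Open Scope ereal_scope.
Hypothesis fin_q : \int[m]_y (q y)%:E < +oo.

Let split_p : \int[m]_y (p y)%:E = \int[m]_y (p y - q y)%:E + \int[m]_y (q y)%:E.
Proof.
rewrite -ge0_integralD//.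
- by apply: eq_integral => y _; rewrite -EFinD subrK.
- by move=> y _; rewrite lee_fin subr_ge0.
- by apply/measurable_EFinP; exact: measurable_funB.
- by move=> y _; rewrite lee_fin.
- exact/measurable_EFinP.
Qed.

Let q_fin : \int[m]_y (q y)%:E \is a fin_num.
Proof. by rewrite ge0_fin_numE// integral_ge0// => y _; rewrite lee_fin. Qed.

Lemma le_integral_sub a : a + \int[m]_y (q y)%:E <= \int[m]_y (p y)%:E ->
  a <= \int[m]_y (p y - q y)%:E.
Proof. by rewrite split_p leeD2rE. Qed.

Lemma ge_integral_sub a : \int[m]_y (p y)%:E <= a + \int[m]_y (q y)%:E ->
  \int[m]_y (p y - q y)%:E <= a.
Proof. by rewrite split_p leeD2rE. Qed.

End density_split.

Section ge0_monotone.
Context d (T : measurableType d) (R : realType) (m : {measure set T -> \bar R}).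
Variables (D : set T) (g : nat -> T -> R) (f : T -> R).
Hypothesis mD : measurable D.
Hypotheses (mg : forall n, measurable_fun setT (g n)) (g0 : forall n x, 0 <= g n x).
Hypotheses (nd : forall x, nondecreasing_seq (g^~ x)).
Hypothesis gf : forall x, g n x @[n --> \oo] --> f x.

Lemma cvg_integral_nondecreasing :
  (\int[m]_(x in D) (g n x)%:E)%E @[n --> \oo] --> (\int[m]_(x in D) (f x)%:E)%E.
Proof.
rewrite [X in _ --> X](_ : _ = (\int[m]_(x in D) limn (fun n => (g n x)%:E))%E); last first.
  apply: eq_integral => x _; apply/esym/cvg_lim => //.
  by apply: cvg_EFin; [exact: nearW|exact: gf].
apply: (@cvg_monotone_convergence _ _ _ m D mD (fun n x => (g n x)%:E)).
- by move=> n; exact/measurable_EFinP/measurable_funTS.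
- by move=> n x _; rewrite lee_fin.
- by move=> x _ a b ab; rewrite lee_fin; exact: nd.
Qed.

End ge0_monotone.

Lemma cvg_gauss (R : realType) (s : R) (x_ : nat -> R) (l : R) : 0 < s ->
  x_ n @[n --> \oo] --> l -> gauss s (x_ n) @[n --> \oo] --> gauss s l.
Proof. by move=> s0; apply: continuous_cvg; exact: continuous_gauss. Qed.

Section exact_density.
Context d (Omega : measurableType d) (R : realType) (P : probability Omega R).
Context (B : brownian_motion P) (mu u v t : R) (t0 : 0 < t) (vu : v < u).
Variable phi : R -> R.
Hypotheses (mphi : measurable_fun setT phi) (phi0 : forall y, 0 <= phi y).
Hypothesis phi1 : forall y, phi y <= 1.
Local Notation leb := (@lebesgue_measure R).
Local Notation W := (drift_weight mu u t).

(** Reflection principle with drift: the difference of the Gaussian density and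
    its image, times the exponential martingale at the endpoint. *)
Definition stay_density (y : R) : R :=
  W * (expR (mu * y) * (gauss t (y - u) - gauss t (2 * v - y - u))).

Section truncated.
Variable M : R.

Let F (c y : R) : R := phi y * \1_`]c, M] y.

Let p (c y : R) : R := W * (expR (mu * y) * F c y) * gauss t (y - u).
Let q (c b y : R) : R := W * (expR (mu * y) * F c y) * gauss t (2 * b - y - u).

Let C : R := expR (`|mu| * (`|v| + `|M|)).

Let W0 : 0 <= W. Proof. exact: expR_ge0. Qed.

Let F0 c y : 0 <= F c y. Proof. by rewrite mulr_ge0. Qed.

Let F1 c y : F c y <= 1.
Proof. by rewrite mulr_ile1// indicE; case: (_ \in _). Qed.

Let FE c y : F c y = if c < y <= M then phi y else 0.
Proof.
by rewrite /F indicE mem_setE in_itv/=; case: ifP => _; rewrite ?mulr1 ?mulr0.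
Qed.

Let Fc c y : y <= c -> F c y = 0.
Proof. by rewrite FE leNgt => /negbTE ->. Qed.

Let mF c : measurable_fun setT (F c).
Proof. by apply: measurable_funM => //; exact: measurable_indic. Qed.

Let mE : measurable_fun setT (fun y => expR (mu * y)).
Proof. by apply: measurableT_comp => //; exact: measurable_funM. Qed.

Let mEF c : measurable_fun setT (fun y => W * (expR (mu * y) * F c y)).
Proof. by apply: measurable_funM => //; exact: measurable_funM. Qed.

Let mp c : measurable_fun setT (p c).
Proof.
apply: measurable_funM => //; apply: measurable_gauss.
exact: measurable_funB.
Qed.

Let mq c b : measurable_fun setT (q c b).
Proof.
apply: measurable_funM => //; apply: measurable_gauss.
by do 2 apply: measurable_funB => //.
Qed.

Let EF0 c y : 0 <= W * (expR (mu * y) * F c y).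
Proof. by rewrite !mulr_ge0// expR_ge0. Qed.

Let p0 c y : 0 <= p c y. Proof. by rewrite mulr_ge0// gauss_ge0. Qed.

Let q0 c b y : 0 <= q c b y. Proof. by rewrite mulr_ge0// gauss_ge0. Qed.

Let C0 : 0 <= C. Proof. exact: expR_ge0. Qed.

Let EFC c y : v <= c -> expR (mu * y) * F c y <= C.
Proof.
move=> vc; rewrite FE; case: ifP => [/andP[cy yM]|_]; last by rewrite mulr0.
apply: (@le_trans _ _ (expR (mu * y))); first by rewrite ler_piMr ?expR_ge0.
rewrite ler_expR (le_trans (ler_norm _))// normrM ler_wpM2l//.
have yv : v <= y by exact: le_trans (ltW cy).
have := ler_norm M; have := ler_norm (- v); rewrite normrN.
rewrite ler_norml; have := normr_ge0 v; have := normr_ge0 M.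
by move=> *; apply/andP; split; lra.
Qed.

Let dist_sub b y : (y - u) ^+ 2 - (2 * b - y - u) ^+ 2 = - (4 * ((y - b) * (u - b))).
Proof. by ring. Qed.

Let qp c b y : b <= c -> b <= u -> q c b y <= p c y.
Proof.
move=> bc bu; have [yc|cy] := leP y c; first by rewrite /q /p Fc// !mulr0 !mul0r.
rewrite ler_wpM2l// le_gauss// -subr_le0 dist_sub oppr_le0 mulr_ge0// mulr_ge0//.
  by rewrite subr_ge0 ltW// (le_lt_trans bc).
by rewrite subr_ge0.
Qed.

Local Open Scope ereal_scope.

Let tiltE c : exp_tilt mu (EFin \o F c) = (fun y => (expR (mu * y) * F c y)%:E).
Proof. by apply/funext => y; rewrite /exp_tilt/= EFinM. Qed.

Let heat_p c : W%:E * heat 0 t (exp_tilt mu (EFin \o F c)) u =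
  \int[leb]_y (p c y)%:E.
Proof.
rewrite tiltE /heat -ge0_integralZl//; last 2 first.
- apply: emeasurable_funM; apply/measurable_EFinP.
    exact: (measurable_funM mE (mF c)).
  by apply: measurable_gauss; do 2 apply: measurable_funB => //.
- move=> y _; rewrite mule_ge0// lee_fin ?gauss_ge0//.
  by rewrite mulr_ge0// expR_ge0.
by apply: eq_integral => y _; rewrite mul0r subr0 -!EFinM mulrA.
Qed.

Let heat_q c b :
  W%:E * heat 0 t (fun y => exp_tilt mu (EFin \o F c) (2 * b - y)%R) u =
  \int[leb]_y (q c b y)%:E.
Proof.
have m1 : measurable_fun setT (fun y => (expR (mu * y) * F c y)%:E).
  by apply/measurable_EFinP; exact: (measurable_funM mE (mF c)).
have m2 y : 0 <= (expR (mu * y) * F c y)%:E.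
  by rewrite lee_fin mulr_ge0// expR_ge0.
rewrite tiltE (@heat_reflection _ b t (fun y => (expR (mu * y) * F c y)%:E) u)//.
rewrite -ge0_integralZl//; last 2 first.
- apply: emeasurable_funM => //; apply/measurable_EFinP.
  by apply: measurable_gauss; do 2 apply: measurable_funB => //.
- by move=> y _; rewrite mule_ge0// lee_fin gauss_ge0.
by apply: eq_integral => y _; rewrite -!EFinM mulrA.
Qed.

Let fin_q c b : (v <= c)%R -> \int[leb]_y (q c b y)%:E < +oo.
Proof.
move=> vc; apply: (@le_lt_trans _ _ (\int[leb]_y ((W * C)%:E *
    (gauss t (y - (2 * b - u)))%:E))).
  apply: ge0_le_integral => //.
  - by move=> y _; rewrite lee_fin.
  - by apply/measurable_EFinP; exact: mq.
  - apply: emeasurable_funM => //; apply/measurable_EFinP/measurable_gauss.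
    exact: measurable_funB.
  move=> y _; rewrite -EFinM lee_fin -[in leRHS]gaussN//.
  rewrite (_ : - (y - (2 * b - u)) = 2 * b - y - u)%R; last by ring.
  by rewrite ler_wpM2r ?gauss_ge0// ler_wpM2l// EFC.
rewrite ge0_integralZl//.
- by rewrite integral_gauss// mule1 ltry.
- apply/measurable_EFinP/measurable_gauss; exact: measurable_funB.
- by move=> y _; rewrite lee_fin gauss_ge0.
- by rewrite lee_fin mulr_ge0.
Qed.

Let a c := \int[P]_(x in stay B mu u v t) (F c (final B mu u t0 x))%:E.

Let cvg_q : \int[leb]_y (q v (v - n.+1%:R^-1) y)%:E @[n --> \oo] -->
  \int[leb]_y (q v v y)%:E.
Proof.
apply: (@cvg_integral_nondecreasing _ _ _ _ setT).
- exact: measurableT.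
- by move=> n; exact: mq.
- by move=> n y; exact: q0.
- move=> y m n mn; have [yv|vy] := leP y v.
    by rewrite /q Fc// !mulr0 !mul0r.
  rewrite ler_wpM2l// le_gauss//.
  have mn' : (n.+1%:R^-1 <= m.+1%:R^-1 :> R)%R by rewrite lef_pV2 ?posrE// ler_nat.
  have n0 : (0 < n.+1%:R^-1 :> R)%R by [].
  move: mn' n0 vy vu; move: (n.+1%:R^-1 : R)%R (m.+1%:R^-1 : R)%R => en em.
  move=> mn' n0 vy uv; rewrite -sqrrN -[leRHS]sqrrN.
  by rewrite ler_pXn2r ?nnegrE//; lra.
move=> y; apply: cvgM; first exact: cvg_cst.
apply: cvg_gauss => //.
apply: cvgB; last exact: cvg_cst.
apply: cvgB; last exact: cvg_cst.
apply: cvgM; first exact: cvg_cst.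
rewrite -[X in _ --> X]subr0; apply: cvgB; first exact: cvg_cst.
exact: cvg_harmonic.
Qed.

Let upper : a v <= \int[leb]_y (p v y - q v v y)%:E.
Proof.
apply: le_integral_sub => //.
- exact: mp.
- exact: mq.
- by move=> y; apply: qp => //; exact: ltW.
- exact: fin_q.
have up n : a v + \int[leb]_y (q v (v - n.+1%:R^-1) y)%:E <= \int[leb]_y (p v y)%:E.
  rewrite -heat_p -heat_q.
  apply: (@stay_upper _ _ _ _ B mu u v t t0 (EFin \o F v) _ _ C) => //.
  - by apply/measurable_EFinP; exact: mF.
  - by move=> y; rewrite lee_fin.
  - by move=> y yv /=; rewrite Fc.
  - by move=> y; rewrite tiltE lee_fin EFC.
have a_fin : a v \is a fin_num.
  rewrite ge0_fin_numE; last by apply: integral_ge0 => x _; rewrite lee_fin.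
  apply: (@le_lt_trans _ _ (\int[P]_(x in stay B mu u v t) cst 1 x)).
    apply: ge0_le_integral => //.
    - exact: measurable_stay.
    - by move=> x _; rewrite lee_fin.
    - apply/measurable_EFinP/measurable_funTS/measurableT_comp => //.
      exact: measurable_final.
    - by move=> x _; rewrite lee_fin.
  rewrite integral_cst; last exact: measurable_stay.
  by rewrite mul1e ltey_eq fin_num_measure//; exact: measurable_stay.
have H : (a v + \int[leb]_y (q v (v - n.+1%:R^-1) y)%:E) @[n --> \oo] -->
    a v + \int[leb]_y (q v v y)%:E.
  by apply: cvgeD; [exact: fin_num_adde_defr|exact: cvg_cst|exact: cvg_q].
rewrite -(cvg_lim _ H)//; apply: lime_le; first by apply/cvg_ex; eexists; exact: H.
exact: nearW.
Qed.

(* [n.+2] keeps the raised barrier [v + e n] below the starting point [u]. *)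
Let e n : R := ((u - v) / n.+2%:R)%R.

Let e0 n : (0 < e n)%R. Proof. by rewrite divr_gt0// subr_gt0. Qed.

Let eu n : (e n < u - v)%R.
Proof. by rewrite /e ltr_pdivrMr// ltr_pMr ?subr_gt0// ltr1n. Qed.

Let nd_e m n : (m <= n)%N -> (e n <= e m)%R.
Proof.
by move=> mn; rewrite ler_pM2l ?subr_gt0// lef_pV2 ?posrE// ler_nat.
Qed.

Let cvg_e : e n @[n --> \oo] --> (0 : R)%R.
Proof.
rewrite -[X in _ --> X](mulr0 (u - v)%R); apply: cvgM; first exact: cvg_cst.
have := @cvg_harmonic R; rewrite -(cvg_shiftS (harmonic : nat -> R)).
exact.
Qed.

Let lower_n n : \int[leb]_y (p (v + e n)%R y - q (v + e n)%R (v + e n)%R y)%:E <= a v.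
Proof.
have := e0 n; have := eu n; move: (e n) => en en0 enu.
have cu : (v + en < u)%R by lra.
have vc : (v < v + en)%R by lra.
apply: (@le_trans _ _ (a (v + en)%R)).
  apply: ge_integral_sub => //.
  - exact: mp.
  - exact: mq.
  - by move=> y; apply: qp => //; exact: ltW.
  - by apply: fin_q; exact: ltW.
  rewrite -heat_p -heat_q.
  apply: (@stay_lower _ _ _ _ B mu u v t t0 (EFin \o F (v + en)%R) _ _ 1) => //.
  - by apply/measurable_EFinP; exact: mF.
  - by move=> y; rewrite lee_fin.
  - by move=> y yv /=; rewrite Fc.
  - by move=> y; rewrite lee_fin.
rewrite /a; apply: ge0_le_integral => //.
- exact: measurable_stay.
- by move=> x _; rewrite lee_fin.
- apply/measurable_EFinP/measurable_funTS/measurableT_comp => //.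
  exact: measurable_final.
- apply/measurable_EFinP/measurable_funTS/measurableT_comp => //.
  exact: measurable_final.
- move=> x _; rewrite lee_fin !FE; case: ifP => [/andP[h1 h2]|_].
    by rewrite (lt_trans vc h1) h2.
  by case: ifP.
Qed.

Let lower : \int[leb]_y (p v y - q v v y)%:E <= a v.
Proof.
have H : \int[leb]_y (p (v + e n)%R y - q (v + e n)%R (v + e n)%R y)%:E @[n --> \oo]
    --> \int[leb]_y (p v y - q v v y)%:E.
  apply: (@cvg_integral_nondecreasing _ _ _ _ setT).
- exact: measurableT.
  - by move=> n; exact: (measurable_funB (mp _) (mq _ _)).
  - move=> n y; rewrite subr_ge0 qp//; have := eu n; lra.
  - move=> y m n mn; have [yc|cy] := leP y (v + e m)%R.
      rewrite [in leLHS]/p [in leLHS]/q Fc// !mulr0 !mul0r subr0 subr_ge0 qp//.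
      by have := eu n; lra.
    have cyn : (v + e n < y)%R by apply: le_lt_trans cy; rewrite lerD2l nd_e.
    have FF : F (v + e m)%R y = F (v + e n)%R y by rewrite !FE cy cyn.
    rewrite /p /q FF lerD2l lerN2 ler_wpM2l// le_gauss//.
    rewrite -sqrrN -[leRHS]sqrrN ler_pXn2r ?nnegrE//; move: cy cyn (eu m) (eu n) (nd_e mn); lra.
  move=> y; have [yv|vy] := leP y v.
    apply: cvg_near_cst; apply: nearW => n.
    have yc : (y <= v + e n)%R by rewrite (le_trans yv)// lerDl ltW.
    by rewrite /p /q !Fc// !mulr0 !mul0r.
  have -> : (p v y - q v v y = W * (expR (mu * y) * F v y) * (gauss t (y - u) -
      gauss t (2 * v - y - u)))%R by rewrite /p /q; ring.
  have G : (W * (expR (mu * y) * F v y) * (gauss t (y - u) -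
      gauss t (2 * (v + e n) - y - u)))%R @[n --> \oo] -->
      (W * (expR (mu * y) * F v y) * (gauss t (y - u) - gauss t (2 * v - y - u)))%R.
    apply: cvgM; first exact: cvg_cst.
    apply: cvgB; first exact: cvg_cst.
    apply: cvg_gauss => //.
    apply: cvgB; last exact: cvg_cst.
    apply: cvgB; last exact: cvg_cst.
    apply: cvgM; first exact: cvg_cst.
    by rewrite -[X in _ --> X]addr0; apply: cvgD; [exact: cvg_cst|exact: cvg_e].
  apply: cvg_trans G; apply: near_eq_cvg.
  have : \forall n \near \oo, (e n < y - v)%R.
    by have /cvgr_lt := cvg_e; apply; rewrite subr_gt0.
  apply: filterS => n ny; have cyn : (v + e n < y)%R by lra.
  by rewrite /p /q (_ : F (v + e n)%R y = F v y) ?FE ?cyn ?vy//; ring.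
rewrite -(cvg_lim _ H)//; apply: lime_le; first by apply/cvg_ex; eexists; exact: H.
by apply: nearW => n; exact: lower_n.
Qed.

(** The two bounds of the sandwich, with barriers [v - e] and [v + e], meet as
    [e] tends to 0, by monotone convergence. The truncation at [M] keeps
    [exp (mu y)] bounded, as [killed_upper] requires. *)
Lemma stay_density_truncated :
  \int[P]_(x in stay B mu u v t) (phi (final B mu u t0 x) *
    \1_`]v, M] (final B mu u t0 x))%:E =
  \int[leb]_y (phi y * \1_`]v, M] y * stay_density y)%:E.
Proof.
transitivity (a v); first by [].
transitivity (\int[leb]_y (p v y - q v v y)%:E).
  by apply/eqP; rewrite eq_le upper lower.
by apply: eq_integral => y _; rewrite /p /q /stay_density -/(F v y); congr (_%:E); ring.
Qed.

End truncated.
End exact_density.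

Section stay_law.
Context d (Omega : measurableType d) (R : realType) (P : probability Omega R).
Context (B : brownian_motion P) (mu u v t : R) (t0 : 0 < t) (vu : v < u).
Variable phi : R -> R.
Hypotheses (mphi : measurable_fun setT phi) (phi0 : forall y, 0 <= phi y).
Hypothesis phi1 : forall y, phi y <= 1.
Local Notation leb := (@lebesgue_measure R).

Lemma stay_density_ge0 y : v <= y -> 0 <= stay_density mu u v t y.
Proof.
move=> vy; rewrite !mulr_ge0 ?expR_ge0// subr_ge0 le_gauss//.
by rewrite -sqrrN -[leRHS]sqrrN; rewrite -subr_ge0; have := vu; nra.
Qed.

Lemma measurable_stay_density : measurable_fun setT (stay_density mu u v t).
Proof.
apply: measurable_funM => //; apply: measurable_funM.
  by apply: measurableT_comp => //; exact: measurable_funM.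
apply: measurable_funB; apply: measurable_gauss.
  exact: measurable_funB.
by do 2 apply: measurable_funB => //.
Qed.

Let trunc (n : nat) (y : R) : R := \1_`]v, n%:R] y.

Let truncE n y : trunc n y = if (v < y) && (y <= n%:R) then 1 else 0.
Proof. by rewrite /trunc indicE mem_setE in_itv/=; case: ifP. Qed.

Let nd_trunc y : nondecreasing_seq (trunc^~ y).
Proof.
move=> m n mn; rewrite !truncE; case: (v < y) => //=.
case: ifP => [ym|_]; last by case: ifP.
by rewrite (le_trans ym)// ler_nat.
Qed.

Let cvg_trunc y : trunc n y @[n --> \oo] --> (\1_`]v, +oo[ y : R).
Proof.
apply: cvg_near_cst; have := nbhs_infty_ger (y : R).
apply: filterS => n yn; rewrite truncE yn andbT indicE mem_setE in_itv/= andbT.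
by case: (v < y).
Qed.

Lemma stay_law :
  (\int[P]_(x in stay B mu u v t) (phi (final B mu u t0 x))%:E =
   \int[leb]_(y in `]v, +oo[) (phi y * stay_density mu u v t y)%:E)%E.
Proof.
pose lhs n := (\int[P]_(x in stay B mu u v t) (phi (final B mu u t0 x) *
    trunc n (final B mu u t0 x))%:E)%E.
have cl : lhs n @[n --> \oo] --> (\int[P]_(x in stay B mu u v t)
    (phi (final B mu u t0 x) * \1_`]v, +oo[ (final B mu u t0 x))%:E)%E.
  apply: (@cvg_integral_nondecreasing _ _ _ _ _
    (fun n x => phi (final B mu u t0 x) * trunc n (final B mu u t0 x))).
  - exact: measurable_stay.
  - move=> n; apply: measurable_funM; apply: measurableT_comp => //.
    + exact: measurable_final.
    + exact: measurable_indic.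
    + exact: measurable_final.
  - by move=> n x; rewrite mulr_ge0.
  - by move=> x m n mn; rewrite ler_wpM2l// nd_trunc.
  - by move=> x; apply: cvgM; [exact: cvg_cst|exact: cvg_trunc].
have cr : lhs n @[n --> \oo] --> (\int[leb]_y
    (phi y * \1_`]v, +oo[ y * stay_density mu u v t y)%:E)%E.
  rewrite (_ : lhs = fun n => (\int[leb]_y
      (phi y * trunc n y * stay_density mu u v t y)%:E)%E); last first.
    by apply/funext => n; exact: stay_density_truncated.
  apply: (@cvg_integral_nondecreasing _ _ _ leb setT
    (fun n y => phi y * trunc n y * stay_density mu u v t y)
    (fun y => phi y * \1_`]v, +oo[ y * stay_density mu u v t y)).
  - exact: measurableT.
  - move=> n; apply: measurable_funM; last exact: measurable_stay_density.
    by apply: measurable_funM => //; exact: measurable_indic.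
  - move=> n y; rewrite truncE; case: ifP => [/andP[vy _]|_].
      by rewrite mulr1 mulr_ge0// stay_density_ge0// ltW.
    by rewrite mulr0 mul0r.
  - move=> y m n mn; have [vy|yv] := ltP v y.
      by rewrite ler_wpM2r ?stay_density_ge0 ?(ltW vy)// ler_wpM2l// nd_trunc.
    by rewrite !truncE ltNge yv.
  - move=> y; apply: cvgM; last exact: cvg_cst.
    by apply: cvgM; [exact: cvg_cst|exact: cvg_trunc].
transitivity (limn lhs).
  rewrite (cvg_lim _ cl)//; apply: eq_integral => x /set_mem sx.
  by rewrite indicE mem_set ?mulr1//= in_itv/= andbT; exact: stay_final.
rewrite (cvg_lim _ cr)// [RHS]integral_mkcond; apply: eq_integral => y _.
rewrite patchE indicE; case: (_ \in _); first by rewrite mulr1.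
by rewrite mulr0 mul0r.
Qed.

End stay_law.

(** * The density as the starting point approaches the barrier *)

Section sinh_kernel.
Context (R : realType) (mu u v t : R) (t0 : 0 < t).
Local Notation leb := (@lebesgue_measure R).

(** Twice [sinh ((y - v) delta / t) / delta]. *)
Definition sinh_ratio (delta y : R) : R :=
  (expR ((y - v) * delta / t) - expR (- ((y - v) * delta / t))) / delta.

Definition tilted_gauss (y : R) : R :=
  expR (- ((y - v) ^+ 2 / (2 * t))) * expR (mu * y).

Definition stay_scale : R := drift_weight mu u t * (Num.sqrt (t * pi *+ 2))^-1 *
  expR (- ((u - v) ^+ 2 / (2 * t))) * (u - v).

Lemma stay_scale_gt0 : v < u -> 0 < stay_scale.
Proof.
move=> vu; rewrite !mulr_gt0 ?expR_gt0 ?subr_gt0// invr_gt0 sqrtr_gt0.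
by rewrite mulrn_wgt0// mulr_gt0 ?pi_gt0.
Qed.

(** The exponents are [- ((y - v) ^+ 2 + (u - v) ^+ 2) / (2 t)] plus or minus
    [(y - v) (u - v) / t], so that up to a factor free of [y] the dependence
    on [u] is all in the hyperbolic sine. *)
Lemma stay_densityE y : v < u -> stay_density mu u v t y =
  stay_scale * (tilted_gauss y * sinh_ratio (u - v) y).
Proof.
move=> vu; rewrite /stay_density /stay_scale /tilted_gauss /sinh_ratio !gaussE//.
set A := expR (- ((y - u) ^+ 2 / (2 * t))).
set A' := expR (- ((2 * v - y - u) ^+ 2 / (2 * t))).
have -> : A = expR (- ((u - v) ^+ 2 / (2 * t))) *
    expR (- ((y - v) ^+ 2 / (2 * t))) * expR ((y - v) * (u - v) / t).
  by rewrite -!expRD; congr expR; field; rewrite gt_eqF.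
have -> : A' = expR (- ((u - v) ^+ 2 / (2 * t))) *
    expR (- ((y - v) ^+ 2 / (2 * t))) * expR (- ((y - v) * (u - v) / t)).
  by rewrite -!expRD; congr expR; field; rewrite gt_eqF.
field; rewrite !gt_eqF ?subr_gt0 ?sqrtr_gt0//.
by rewrite mulrn_wgt0// mulr_gt0 ?pi_gt0.
Qed.

Let expB (x : R) : expR x - expR (- x) = expR (- x) * (expR (2 * x) - 1).
Proof. by rewrite mulrBr mulr1 -expRD; congr (expR _ - _); ring. Qed.

Lemma sinh_ratio_lb delta y : 0 < delta -> v <= y ->
  2 * ((y - v) / t) * expR (- ((y - v) * delta / t)) <= sinh_ratio delta y.
Proof.
move=> d0 vy; rewrite /sinh_ratio ler_pdivlMr// expB.
have -> : 2 * ((y - v) / t) * expR (- ((y - v) * delta / t)) * delta =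
  expR (- ((y - v) * delta / t)) * (2 * ((y - v) * delta / t)) by ring.
rewrite ler_wpM2l ?expR_ge0//; have := expR_ge1Dx (2 * ((y - v) * delta / t)).
lra.
Qed.

Lemma sinh_ratio_ub delta y : 0 < delta -> v <= y ->
  sinh_ratio delta y <= 2 * ((y - v) / t) * expR ((y - v) * delta / t).
Proof.
move=> d0 vy; rewrite /sinh_ratio ler_pdivrMr//.
have -> : 2 * ((y - v) / t) * expR ((y - v) * delta / t) * delta =
  expR ((y - v) * delta / t) * (2 * ((y - v) * delta / t)) by ring.
set x := (y - v) * delta / t.
have -> : expR x - expR (- x) = expR x * (1 - expR (- (2 * x))).
  by rewrite mulrBr mulr1 -expRD; congr (_ - expR _); ring.
rewrite ler_wpM2l ?expR_ge0//; have := expR_ge1Dx (- (2 * x)); lra.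
Qed.

Lemma sinh_ratio_gt0 delta y : 0 < delta -> v < y -> 0 < sinh_ratio delta y.
Proof.
move=> d0 vy; apply: lt_le_trans (sinh_ratio_lb d0 (ltW vy)).
by rewrite !mulr_gt0 ?expR_gt0// ?invr_gt0// subr_gt0.
Qed.

(** The bound [2 s exp (s delta)] with [s = (y - v) / t] is at most
    [2 (exp s - 1) exp s], which is at most [4 sinh (2 s)]. Times the
    tilted Gaussian, the bound is up to a constant the density for a starting
    point at distance 2, so its integrability comes from the total mass of a
    probability. *)
Lemma sinh_ratio_dominated delta y : 0 < delta <= 1 -> v <= y ->
  sinh_ratio delta y <= 4 * sinh_ratio 2 y.
Proof.
move=> /andP[d0 d1] vy; apply: (le_trans (sinh_ratio_ub d0 vy)).
set s := (y - v) / t.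
have s0 : 0 <= s by rewrite divr_ge0 ?subr_ge0// ltW.
have -> : 4 * sinh_ratio 2 y = 2 * (expR s ^+ 2 - expR (- (2 * s))).
  rewrite /sinh_ratio -expRM_natl (_ : (y - v) * 2 / t = 2 * s); last by rewrite /s; ring.
  by field.
have -> : (y - v) * delta / t = s * delta by rewrite /s; ring.
have E1 : 1 + s <= expR s by exact: expR_ge1Dx.
have E2 : expR (s * delta) <= expR s by rewrite ler_expR ler_piMr.
have E3 : expR (- (2 * s)) <= 1 by rewrite expR_le1 oppr_le0 mulr_ge0.
apply: (@le_trans _ _ (2 * s * expR s)); first by rewrite ler_wpM2l// mulr_ge0.
by move: E1 E3; move: (expR s) (expR (- (2 * s))) => E F; nra.
Qed.

Lemma sinh_ratio_cvg (delta : nat -> R) y : (forall n, 0 < delta n) ->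
  delta n @[n --> \oo] --> 0 -> v <= y ->
  sinh_ratio (delta n) y @[n --> \oo] --> 2 * ((y - v) / t).
Proof.
move=> d0 dc vy.
have ce : (y - v) * delta n / t @[n --> \oo] --> (0 : R).
  rewrite (_ : (0 : R) = (y - v) * 0 / t); last by ring.
  by apply: cvgM; [apply: cvgM => //; exact: cvg_cst|exact: cvg_cst].
apply: (@squeeze_cvgr _ _ _ _
  (fun n => 2 * ((y - v) / t) * expR (- ((y - v) * delta n / t)))
  (fun n => 2 * ((y - v) / t) * expR ((y - v) * delta n / t))).
- by apply: nearW => n; rewrite sinh_ratio_lb// sinh_ratio_ub.
- rewrite -[X in _ --> X]mulr1 -expR0 -[X in expR X]oppr0.
  apply: cvgM; first exact: cvg_cst.
  by apply: continuous_cvg; [exact: continuous_expR|exact: cvgN].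
- rewrite -[X in _ --> X]mulr1 -expR0.
  apply: cvgM; first exact: cvg_cst.
  by apply: continuous_cvg => //; exact: continuous_expR.
Qed.

End sinh_kernel.

(** * The conditioned law *)

Lemma integral_gt0 d (T : measurableType d) (R : realType)
    (m : {measure set T -> \bar R}) (D : set T) (f : T -> R) : measurable D ->
  measurable_fun setT f -> (forall x, D x -> 0 < f x) -> m D != 0%E ->
  (0 < \int[m]_(x in D) (f x)%:E)%E.
Proof.
move=> mD mf f0 mD0; rewrite lt0e integral_ge0 ?andbT; last first.
  by move=> x Dx; rewrite lee_fin ltW// f0.
apply/negP => /eqP int0.
have mDf : measurable_fun D (EFin \o f).
  by apply/measurable_EFinP/measurable_funTS.
have /(ae_eq_integral_abs m mD mDf) [N [mN N0 DN]] :
    (\int[m]_(x in D) `|(EFin \o f) x| = 0)%E.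
  rewrite -int0; apply: eq_integral => x /set_mem Dx /=.
  by rewrite ger0_norm// ltW// f0.
move/eqP: mD0; apply; apply/eqP; rewrite eq_le measure_ge0 andbT -N0.
apply: le_measure; rewrite ?inE// => x Dx; apply: DN => /(_ Dx) /= [fx0].
by have := f0 _ Dx; rewrite fx0 ltxx.
Qed.

Section evaluation.
Context (R : realType) (t : R).

Lemma continuous_eval (s : set_type `[0, t]%classic) :
  continuous (fun w : cpath t => w s).
Proof.
move=> w A /nbhs_ballP[e /= e0 eA]; apply/nbhs_ballP; exists e => //= w'.
by move=> /cpath_ballE ww'; apply: eA; exact: ww'.
Qed.

Lemma measurable_eval (s : set_type `[0, t]%classic) :
  measurable_fun setT (fun w : cpath t => w s).
Proof.
have := @measurability _ _ (cpath t) _ setT (fun w : cpath t => w s) _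
  (RGenOInfty.measurableE R).
apply.
move=> _ [_ [x ->] <-]; rewrite setTI; apply: sub_sigma_algebra.
apply: open_comp; last exact: interval_open.
by move=> w _; exact: continuous_eval.
Qed.

End evaluation.

Section conditioned_expectation.
Context d (Omega : measurableType d) (R : realType) (P : probability Omega R).
Context (B : brownian_motion P) (mu u v t : R) (t0 : 0 < t).
Hypothesis stay0 : P (stay B mu u v t) != 0%E.
Variable phi : R -> R.
Hypotheses (mphi : measurable_fun setT phi) (phi0 : forall y, 0 <= phi y).

Let k : R := (fine (P (stay B mu u v t)))^-1.

Let k0 : 0 <= k. Proof. by rewrite invr_ge0 fine_ge0. Qed.

Let E : set (cpath t) := [set w | v < inf (range w)].

Let mE : measurable E. Proof. exact: measurable_inf_gt. Qed.

Let mk : measurable_fun setT (fun w : cpath t => k * \1_E w).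
Proof. by apply: measurable_funM => //; exact: measurable_indic. Qed.

Let condE (A : set (cpath t)) : measurable A -> conditioned_drift_law B mu t u v A =
  (\int[drift_law B mu t u]_(w in A) (k * \1_E w)%:E)%E.
Proof.
move=> mA; have lawE C : drift_law B mu t u C = P (drift_path B mu t u @^-1` C) by [].
under eq_integral do rewrite EFinM.
rewrite ge0_integralZl//; last first.
  by apply/measurable_EFinP/measurable_funTS/measurable_indic.
rewrite integral_indic//.
pose mr := mrestr (drift_law B mu t u) (measurable_inf_gt (t:=t) v).
have evE : mr setT = P (stay B mu u v t) by rewrite /mr /mrestr setTI.
have ev : (mr setT == 0%E) || (mr setT == +oo%E) = false.
  rewrite evE; apply/negP => /orP[|/eqP Poo]; first exact/negP.
  have : P (stay B mu u v t) \is a fin_num.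
    by apply: fin_num_measure; exact: measurable_stay.
  by rewrite Poo.
transitivity (mnormalize mr (drift_law B mu t u) A); first by [].
transitivity (mr A * (fine (mr setT))^-1%:E)%E; first by rewrite /mnormalize ev.
rewrite evE muleC; congr (_ * _)%E.
by rewrite /mr /mrestr setIC.
Qed.

(** Elementary conditioning, transported from the path space to [Omega]. *)
Lemma integral_conditioned_drift_law :
  (\int[conditioned_drift_law B mu t u v]_w (phi (w (endpoint t0)))%:E =
   k%:E * \int[P]_(x in stay B mu u v t) (phi (final B mu u t0 x))%:E)%E.
Proof.
have mf : measurable_fun setT (fun w : cpath t => (phi (w (endpoint t0)))%:E).
  by apply/measurable_EFinP/measurableT_comp => //; exact: measurable_eval.
rewrite (@ge0_integral_density _ _ _ _ _ _ mk _ condE)//; last 2 first.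
- by move=> w; rewrite mulr_ge0.
- by move=> w; rewrite lee_fin.
have mg : measurable_fun setT
    (fun w : cpath t => ((phi (w (endpoint t0)))%:E * (k * \1_E w)%:E)%E).
  by apply: emeasurable_funM => //; exact/measurable_EFinP.
rewrite ge0_integral_pushforward//; last first.
  by move=> w _; rewrite mule_ge0// lee_fin ?mulr_ge0.
rewrite preimage_setT -ge0_integralZl//; last 3 first.
- exact: measurable_stay.
- apply/measurable_EFinP/measurable_funTS/measurableT_comp => //.
  exact: measurable_final.
- by move=> x _; rewrite lee_fin.
rewrite [RHS]integral_mkcond; apply: eq_integral => x _.
rewrite patchE /= indicE /final.
have -> : (drift_path B mu t u x \in E) = (x \in stay B mu u v t).
  by apply/idP/idP => /set_mem ?; exact/mem_set.
by case: ifP => _; rewrite ?mulr1 ?mulr0 ?mule0// -!EFinM mulrC.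
Qed.

End conditioned_expectation.

(** * The weak limit *)

Section meander_limit.
Context d (Omega : measurableType d) (R : realType) (P : probability Omega R).
Context (B : brownian_motion P) (mu v t : R) (t0 : 0 < t).
Local Notation leb := (@lebesgue_measure R).

Definition meander_weight (y : R) : R :=
  (y - v) * expR (- ((y - v) ^+ 2 / (2 * t))) * expR (mu * y).

Definition meander_mass : R := (\int[leb]_(y in `]v, +oo[) meander_weight y)%R.

Lemma measurable_meander_weight : measurable_fun setT meander_weight.
Proof.
apply: measurable_funM; last by apply: measurableT_comp => //; exact: measurable_funM.
apply: measurable_funM; first exact: measurable_funB.
apply: measurableT_comp => //; apply: measurableT_comp => //.
by apply: measurable_funM => //; apply: measurable_funX; exact: measurable_funB.
Qed.

Lemma meander_weight_gt0 y : v < y -> 0 < meander_weight y.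
Proof. by move=> vy; rewrite !mulr_gt0 ?expR_gt0 ?subr_gt0. Qed.

Let integrand (delta y : R) : R := tilted_gauss mu v t y * sinh_ratio v t delta y.

Let measurable_integrand delta : measurable_fun setT (integrand delta).
Proof.
apply: measurable_funM.
  apply: measurable_funM; last by apply: measurableT_comp => //; exact: measurable_funM.
  apply: measurableT_comp => //; apply: measurableT_comp => //.
  by apply: measurable_funM => //; apply: measurable_funX; exact: measurable_funB.
have m1 : measurable_fun setT (fun y : R => (y - v) * delta / t).
  by do 2 apply: measurable_funM => //; exact: measurable_funB.
apply: measurable_funM => //; apply: measurable_funB.
  exact: measurableT_comp.
by apply: measurableT_comp => //; exact: measurableT_comp.
Qed.

Let integrand_gt0 delta y : 0 < delta -> v < y -> 0 < integrand delta y.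
Proof.
move=> d0 vy; apply: mulr_gt0; last exact: sinh_ratio_gt0.
by rewrite mulr_gt0 ?expR_gt0.
Qed.

Let D : set R := `]v, +oo[%classic.

Let mD : measurable D. Proof. exact: measurable_itv. Qed.

Let DP y : D y -> v < y. Proof. by rewrite /D/= in_itv/= andbT. Qed.

Let J (delta : R) (phi : R -> R) : \bar R :=
  (\int[leb]_(y in D) (phi y * integrand delta y)%:E)%E.

Let I (phi : R -> R) : \bar R :=
  (\int[leb]_(y in D) (phi y * meander_weight y)%:E)%E.

Let stay_J delta (phi : R -> R) : 0 < delta -> measurable_fun setT phi ->
  (forall y, 0 <= phi y) -> (forall y, phi y <= 1) ->
  (\int[P]_(x in stay B mu (v + delta) v t) (phi (final B mu (v + delta) t0 x))%:E =
   (stay_scale mu (v + delta) v t)%:E * J delta phi)%E.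
Proof.
move=> d0 mphi phi0 phi1; have vu : v < v + delta by rewrite ltrDl.
rewrite stay_law// -ge0_integralZl//.
- apply: eq_integral => y _; rewrite stay_densityE// -EFinM; congr (_%:E).
  by rewrite /integrand (_ : v + delta - v = delta); ring.
- apply/measurable_EFinP/measurable_funTS.
  by apply: measurable_funM => //; exact: measurable_integrand.
- by move=> y /DP vy; rewrite lee_fin mulr_ge0// ltW// integrand_gt0.
- by rewrite lee_fin ltW// stay_scale_gt0.
Qed.

Let stay_J1 delta : 0 < delta -> P (stay B mu (v + delta) v t) =
  ((stay_scale mu (v + delta) v t)%:E * J delta (cst 1%R))%E.
Proof.
move=> d0; rewrite -stay_J//= integral_cst ?mul1e//; exact: measurable_stay.
Qed.

Let J1_gt0 delta : 0 < delta -> (0 < J delta (cst 1%R))%E.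
Proof.
move=> d0; apply: integral_gt0 => //.
- by apply: measurable_funM => //; exact: measurable_integrand.
- by move=> y /DP vy; rewrite mul1r integrand_gt0.
- have DE : leb D = +oo%E by rewrite lebesgue_measure_itv/= ltry.
  by apply/eqP => D0; have := etrans (esym DE) D0.
Qed.

(** Up to a positive factor, this integral is the probability of an event. *)
Let J1_fin delta : 0 < delta -> (J delta (cst 1%R) < +oo)%E.
Proof.
move=> d0; rewrite ltNge leye_eq; apply/negP => /eqP Joo.
have := stay_J1 d0; rewrite Joo gt0_muley; last first.
  by rewrite lte_fin stay_scale_gt0// ltrDl.
move=> Poo; have : P (stay B mu (v + delta) v t) \is a fin_num.
  by apply: fin_num_measure; exact: measurable_stay.
by rewrite Poo.
Qed.

Let delta (n : nat) : R := n.+1%:R^-1.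

Let delta_gt0 n : 0 < delta n. Proof. by rewrite invr_gt0. Qed.

Let J_cvg (phi : R -> R) : measurable_fun setT phi ->
  (forall y, 0 <= phi y) -> (forall y, phi y <= 1) ->
  I phi \is a fin_num /\
  J (delta n) phi @[n --> \oo] --> ((2 / t)%:E * I phi)%E.
Proof.
move=> mphi phi0 phi1.
have mw : measurable_fun setT (fun y => phi y * meander_weight y).
  by apply: measurable_funM => //; exact: measurable_meander_weight.
have t2 : 0 < 2 / t by rewrite divr_gt0.
have [] := @dominated_convergence _ _ _ leb D mD
  (fun n y => (phi y * integrand (delta n) y)%:E)
  (fun y => (2 / t * (phi y * meander_weight y))%:E)
  (fun y => (4 * integrand 2 y)%:E).
- move=> n; apply/measurable_EFinP/measurable_funTS.
  by apply: measurable_funM => //; exact: measurable_integrand.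
- by apply/measurable_EFinP/measurable_funTS/measurable_funM.
- apply: aeW => y /DP vy; apply: cvg_EFin; first exact: nearW.
  rewrite (_ : 2 / t * _ = phi y * (tilted_gauss mu v t y * (2 * ((y - v) / t)))).
    apply: cvgM; first exact: cvg_cst.
    apply: cvgM; first exact: cvg_cst.
    apply: sinh_ratio_cvg => //; [exact: cvg_harmonic|exact: ltW].
  by rewrite /meander_weight /tilted_gauss; ring.
- apply/integrableP; split.
    apply/measurable_EFinP/measurable_funTS/measurable_funM => //.
    exact: measurable_integrand.
  rewrite (_ : (\int[leb]_(y in D) _ = 4%:E * J 2 (cst 1%R))%E).
    by rewrite lte_mul_pinfty// J1_fin.
  rewrite /J -ge0_integralZl//.
  + apply: eq_integral => y /set_mem /DP vy /=.
    by rewrite mul1r -EFinM ger0_norm// mulr_ge0// ltW// integrand_gt0.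
  + apply/measurable_EFinP/measurable_funTS/measurable_funM => //.
    exact: measurable_integrand.
  + by move=> y /DP vy; rewrite lee_fin mul1r ltW// integrand_gt0.
- apply: aeW => y n /DP vy; rewrite lee_fin ger0_norm; last first.
    by rewrite mulr_ge0// ltW// integrand_gt0.
  apply: (@le_trans _ _ (integrand (delta n) y)).
    by rewrite ler_piMl// ltW// integrand_gt0.
  have -> : 4 * integrand 2 y = tilted_gauss mu v t y * (4 * sinh_ratio v t 2 y).
    by rewrite /integrand; ring.
  apply: ler_wpM2l.
    by rewrite mulr_ge0// expR_ge0.
  apply: sinh_ratio_dominated => //; last exact: ltW.
  by rewrite delta_gt0/= invf_le1// ler1n.
move=> int_f _ cv.
have IE : (\int[leb]_(y in D) (2 / t * (phi y * meander_weight y))%:E =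
    (2 / t)%:E * I phi)%E.
  rewrite /I -ge0_integralZl//.
  - exact/measurable_EFinP/measurable_funTS.
  - by move=> y /DP vy; rewrite lee_fin mulr_ge0// ltW// meander_weight_gt0.
  - by rewrite lee_fin ltW.
have I0 : (0 <= I phi)%E.
  by apply: integral_ge0 => y /DP vy; rewrite lee_fin mulr_ge0// ltW// meander_weight_gt0.
split; last by rewrite -IE.
have := @integrable_fin_num _ _ _ leb D mD _ int_f; rewrite IE.
rewrite ge0_fin_numE ?mule_ge0 ?lee_fin ?(ltW t2)// => fI.
rewrite ge0_fin_numE// ltNge leye_eq; apply/negP => /eqP Ioo.
by move: fI; rewrite Ioo gt0_muley ?ltxx// lte_fin.
Qed.

Let one_fin : I (cst 1%R) \is a fin_num.
Proof. by have [] // := @J_cvg (cst 1%R) (measurable_cst _). Qed.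

Lemma meander_massE :
  (meander_mass%:E = \int[leb]_(y in `]v, +oo[) (meander_weight y)%:E)%E.
Proof.
have IE : I (cst 1%R) = (\int[leb]_(y in D) (meander_weight y)%:E)%E.
  by apply: eq_integral => y _; rewrite mul1r.
by rewrite /meander_mass /Rintegral fineK//; move: one_fin; rewrite IE.
Qed.

Let I_one : I (cst 1%R) = meander_mass%:E.
Proof. by rewrite meander_massE; apply: eq_integral => y _; rewrite mul1r. Qed.

Lemma meander_mass_gt0 : 0 < meander_mass.
Proof.
rewrite -lte_fin meander_massE; apply: integral_gt0 => //.
- exact: measurable_meander_weight.
- by move=> y /DP; exact: meander_weight_gt0.
- have DE : leb D = +oo%E by rewrite lebesgue_measure_itv/= ltry.
  by apply/eqP => D0; have := etrans (esym DE) D0.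
Qed.

(** The factor [stay_scale] is common to numerator and denominator. *)
Let conditioned_J (phi : R -> R) n : measurable_fun setT phi ->
  (forall y, 0 <= phi y) -> (forall y, phi y <= 1) ->
  (\int[conditioned_drift_law B mu t (v + delta n) v]_w phi (w (endpoint t0)))%R =
  fine (J (delta n) phi) / fine (J (delta n) (cst 1%R)).
Proof.
move=> mphi phi0 phi1; have d0 := delta_gt0 n.
have vu : v < v + delta n by rewrite ltrDl.
have s0 := stay_scale_gt0 mu t0 vu.
have J1 := J1_gt0 d0; have J1oo := J1_fin d0.
have J1f : J (delta n) (cst 1%R) \is a fin_num by rewrite ge0_fin_numE// ltW.
rewrite /Rintegral integral_conditioned_drift_law//; last first.
  by rewrite stay_J1// gt_eqF// mule_gt0// lte_fin.
rewrite stay_J1// stay_J//.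
have Jphi0 : (0 <= J (delta n) phi)%E.
  apply: integral_ge0 => y /DP vy; rewrite lee_fin mulr_ge0// ltW//.
  exact: integrand_gt0.
have Jphif : J (delta n) phi \is a fin_num.
  rewrite ge0_fin_numE//; apply: le_lt_trans J1oo; apply: ge0_le_integral => //.
  - by move=> y /DP vy; rewrite lee_fin mulr_ge0// ltW// integrand_gt0.
  - apply/measurable_EFinP/measurable_funTS/measurable_funM => //.
    exact: measurable_integrand.
  - apply/measurable_EFinP/measurable_funTS/measurable_funM => //.
    exact: measurable_integrand.
  - by move=> y /DP vy; rewrite lee_fin ler_wpM2r// ltW// integrand_gt0.
rewrite -(fineK Jphif) -(fineK J1f) -!EFinM /=.
have J1r : 0 < fine (J (delta n) (cst 1%R)) by rewrite fine_gt0// J1 J1oo.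
by field; rewrite !gt_eqF.
Qed.

(** Along the starting points [v + 1/(n+1)], numerator and denominator of the
    conditional expectation, freed of their common factor, converge by dominated
    convergence to integrals against [2 / t] times [meander_weight]; the
    expectation under the weak limit is the limit of the quotients. *)
Lemma meander_endpoint_expectation (Q : probability (cpath t) R) (phi : R -> R) :
  meander_law B mu v Q -> continuous phi ->
  (forall y, 0 <= phi y) -> (forall y, phi y <= 1) ->
  (\int[Q]_w (phi (w (endpoint t0)))%:E =
   \int[leb]_(y in `]v, +oo[) (phi y * (meander_weight y / meander_mass))%:E)%E.
Proof.
move=> QB cphi phi0 phi1.
have mphi : measurable_fun setT phi by exact: continuous_measurable_fun.
pose f (w : cpath t) := phi (w (endpoint t0)).
have cf : continuous f.
  by move=> w; apply: continuous_comp; [exact: continuous_eval|exact: cphi].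
have bf : bounded_fun f.
  exists 1; split => // M M1 w _; rewrite /= ger0_norm ?phi0//.
  by apply: le_trans (phi1 _) _; exact: ltW.
have mf : measurable_fun setT f.
  by apply: measurableT_comp => //; exact: measurable_eval.
have [fI Iphi] := J_cvg mphi phi0 phi1.
have [_ I1] := J_cvg (measurable_cst _) (fun=> ler01) (fun=> lexx _) : _ /\ _.
have Qf := QB f cf bf.
have seqQ : (\int[conditioned_drift_law B mu t (v + delta n) v]_w f w)%R @[n --> \oo]
    --> (\int[Q]_w f w)%R.
  move: Qf => /cvg_at_rightP; apply; split=> [n|]; first by rewrite ltrDl.
  rewrite -[X in _ --> X]addr0; apply: cvgD; first exact: cvg_cst.
  exact: cvg_harmonic.
have t2 : 0 < 2 / t by rewrite divr_gt0.
have seqI : (\int[conditioned_drift_law B mu t (v + delta n) v]_w f w)%R @[n --> \oo]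
    --> fine (I phi) / meander_mass.
  have -> : fine (I phi) / meander_mass =
      (2 / t * fine (I phi)) * (2 / t * meander_mass)^-1.
    by field; rewrite !gt_eqF// meander_mass_gt0.
  rewrite (_ : (fun n => _) = fun n => fine (J (delta n) phi) *
      (fine (J (delta n) (cst 1%R)))^-1); last first.
    by apply/funext => n; exact: conditioned_J.
  apply: cvgM.
    by apply: fine_cvg; rewrite EFinM fineK.
  apply: cvgV; first by rewrite gt_eqF// mulr_gt0// meander_mass_gt0.
  by apply: fine_cvg; rewrite EFinM -I_one.
have QE : (\int[Q]_w f w)%R = fine (I phi) / meander_mass.
  by rewrite -(cvg_lim _ seqQ)// (cvg_lim _ seqI).
have Qfin : (\int[Q]_w (f w)%:E)%E \is a fin_num.
  rewrite ge0_fin_numE; last by apply: integral_ge0 => w _; rewrite lee_fin phi0.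
  apply: (@le_lt_trans _ _ (\int[Q]_w cst 1%E w)%E).
    apply: ge0_le_integral => //.
    - by move=> w _; rewrite lee_fin phi0.
    - exact/measurable_EFinP.
    - by move=> w _; rewrite lee_fin phi1.
  rewrite integral_cst// mul1e.
  by apply: le_lt_trans (probability_le1 Q measurableT) _; rewrite ltry.
rewrite -[LHS]fineK// [fine _]QE EFinM fineK// muleC -ge0_integralZl//.
- by apply: eq_integral => y _; rewrite -EFinM; congr (_%:E); ring.
- apply/measurable_EFinP/measurable_funTS/measurable_funM => //.
  exact: measurable_meander_weight.
- by move=> y /DP vy; rewrite lee_fin mulr_ge0// ltW// meander_weight_gt0.
- by rewrite lee_fin invr_ge0 ltW// meander_mass_gt0.
Qed.

End meander_limit.

(** * Identification of the law of the endpoint *)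

Section ramps.
Context (R : realType).

(** Bounded continuous functions increasing to the indicator of an open
    half-line, so that weak convergence determines the law of the endpoint. *)
Definition ramp (r : R) (n : nat) (y : R) : R :=
  Num.min 1 (n%:R * Num.max 0 (y - r)).

Lemma ramp_ge0 r n y : 0 <= ramp r n y.
Proof. by rewrite le_min ler01/= mulr_ge0// le_max lexx. Qed.

Lemma ramp_le1 r n y : ramp r n y <= 1.
Proof. by rewrite ge_min lexx. Qed.

Lemma continuous_ramp r n : continuous (ramp r n).
Proof.
pose g : R -> R^o := cst 0 \max (fun y => y - r).
have cg : continuous g.
  move=> y; apply: continuous_max; first exact: cst_continuous.
  by apply: cvgB; [exact: cvg_id|exact: cvg_cst].
move=> y; apply: (@continuous_min R R (cst 1) (fun y => n%:R * g y)).
  exact: cst_continuous.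
by apply: cvgM; [exact: cvg_cst|exact: cg].
Qed.

Lemma nd_ramp r y : nondecreasing_seq ((ramp r)^~ y).
Proof.
move=> m n mn; rewrite le_min !ge_min lexx/=; apply/orP; right.
by rewrite ler_wpM2r ?le_max ?lexx// ler_nat.
Qed.

Lemma cvg_ramp r y : ramp r n y @[n --> \oo] --> (\1_`]r, +oo[ y : R).
Proof.
apply: cvg_near_cst; rewrite indicE mem_setE in_itv/= andbT.
have [ry|yr] := ltP r y.
  have := nbhs_infty_ger ((y - r)^-1); apply: filterS => n yn.
  rewrite /ramp max_r ?subr_ge0 ?ltW// min_l//.
  by rewrite -ler_pdivrMr ?subr_gt0// mul1r.
by apply: nearW => n; rewrite /ramp max_l ?subr_le0// mulr0 min_r.
Qed.

End ramps.

Section rayleigh_mass.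
Context (R : realType) (v t : R) (t0 : 0 < t).
Local Notation leb := (@lebesgue_measure R).

Let f (y : R) : R := (y - v) * expR (- ((y - v) ^+ 2 / (2 * t))).

Let F (y : R) : R := - t * expR (- ((y - v) ^+ 2 / (2 * t))).

Let dF (y : R) : is_derive y 1 F (f y).
Proof.
pose g (y : R) : R := - (2 * t)^-1 * (y - v) ^+ 2.
have dg : is_derive y 1 g (- (y - v) / t).
  have db : is_derive y 1 (fun y : R => y - v) 1.
    by apply: is_derive_eq; rewrite subr0.
  rewrite (_ : g = (- (2 * t)^-1) \*: ((fun y : R => y - v) ^+ 2)); last first.
    by apply/funext => z; rewrite /g /= fctE.
  apply: is_derive_eq; rewrite /GRing.scale/= expr1.
  by field; rewrite gt_eqF.
rewrite (_ : F = (- t) \*: (expR \o g)); last first.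
  apply/funext => z; rewrite /F /g /=; congr (_ * expR _).
  by field; rewrite gt_eqF.
apply: is_derive_eq; rewrite /GRing.scale/= /f /g.
have -> : expR (- (2 * t)^-1 * (y - v) ^+ 2) = expR (- ((y - v) ^+ 2 / (2 * t))).
  by congr expR; field; rewrite gt_eqF.
by field; rewrite gt_eqF.
Qed.

Let continuous_F : continuous F.
Proof. by move=> y; apply/differentiable_continuous/derivable1_diffP; apply: ex_derive. Qed.

Let continuous_f : continuous f.
Proof.
move=> y; have -> : f = (fun y => (y - v) * (- t^-1 * F y)).
  by apply/funext => z; rewrite /f /F; field; rewrite gt_eqF.
apply: cvgM; first by apply: cvgB; [exact: cvg_id|exact: cvg_cst].
by apply: cvgM; [exact: cvg_cst|exact: continuous_F].
Qed.

Let F_infty : F y @[y --> +oo] --> (0 : R).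
Proof.
rewrite -[X in _ --> X](mulr0 (- t)); apply: cvgM; first exact: cvg_cst.
have s0 : 0 < (Num.sqrt (2 * t))^-1 by rewrite invr_gt0 sqrtr_gt0 mulr_gt0.
rewrite (_ : (fun y => _) = (@gauss_fun R) \o
    (fun y => (y - v) * (Num.sqrt (2 * t))^-1)); last first.
  by apply/funext => y; rewrite /gauss_fun/= exprMn exprVn sqr_sqrtr// mulr_ge0// ltW.
apply: (cvg_comp (fun y => (y - v) * (Num.sqrt (2 * t))^-1) (@gauss_fun R)).
  by apply/gt0_cvgMly => //; exact: cvg_addrr.
exact: cvg_gauss_fun.
Qed.

(** [- t exp (- (y - v) ^+ 2 / (2 t))] is a primitive of the integrand. *)
Lemma rayleigh_mass : (\int[leb]_(y in `]v, +oo[) (f y)%:E = t%:E)%E.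
Proof.
rewrite integral_itv_obnd_cbnd; last first.
  apply/measurable_EFinP/measurable_funTS.
  by apply: continuous_measurable_fun; exact: continuous_f.
rewrite (@ge0_continuous_FTC2y _ f F v 0)//.
- by rewrite -EFinB /F subrr expr0n/= mul0r oppr0 expR0 mulr1 sub0r opprK.
- by move=> y vy; rewrite mulr_ge0 ?expR_ge0// subr_ge0.
- exact: continuous_subspaceT.
- exact/cvg_at_right_filter/continuous_F.
- by move=> y _; rewrite derive1E; have [] := dF y.
Qed.

End rayleigh_mass.

Section meander_endpoint.
Context d (Omega : measurableType d) (R : realType) (P : probability Omega R).
Context (B : brownian_motion P) (mu v t : R) (t0 : 0 < t).
Local Notation leb := (@lebesgue_measure R).
Variable Q : probability (cpath t) R.
Hypothesis QB : meander_law B mu v Q.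

Let rho (y : R) : R := meander_weight mu v t y / meander_mass mu v t.

Let D : set R := `]v, +oo[%classic.

Let mD : measurable D. Proof. exact: measurable_itv. Qed.

Let rho_ge0 y : D y -> 0 <= rho y.
Proof.
rewrite /D/= in_itv/= andbT => vy; rewrite divr_ge0// ltW//.
  exact: meander_weight_gt0.
exact: (meander_mass_gt0 B).
Qed.

Let mrho : measurable_fun setT rho.
Proof. by apply: measurable_funM => //; exact: measurable_meander_weight. Qed.

Let rhoD (y : R) : R := rho y * \1_D y.

Let rhoD_ge0 y : 0 <= rhoD y.
Proof.
rewrite /rhoD indicE; case: (boolP (y \in D)) => [/set_mem Dy|_].
  by rewrite mulr1 rho_ge0.
by rewrite mulr0.
Qed.

Let mrhoD : measurable_fun setT rhoD.
Proof. by apply: measurable_funM => //; exact: measurable_indic. Qed.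

Let integral_rhoD (A : set R) (g : R -> R) :
  (\int[leb]_(y in A `&` D) (g y * rho y)%:E =
   \int[leb]_(y in A) (g y * rhoD y)%:E)%E.
Proof.
rewrite integral_mkcondr; apply: eq_integral => y _.
by rewrite patchE /rhoD indicE; case: (y \in D); rewrite ?mulr1 ?mulr0.
Qed.

Let law : set R -> \bar R :=
  pushforward Q (fun w : cpath t => w (endpoint t0)).

Let density (A : set R) : \bar R := (\int[leb]_(y in A) (rhoD y)%:E)%E.

Let law_ray r : law `]r, +oo[ = density `]r, +oo[.
Proof.
have cl : (\int[Q]_w (ramp r n (w (endpoint t0)))%:E)%E @[n --> \oo] -->
    (\int[Q]_w (\1_`]r, +oo[ (w (endpoint t0)))%:E)%E.
  apply: (@cvg_integral_nondecreasing _ _ _ Q setT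
    (fun n w => ramp r n (w (endpoint t0)))
    (fun w => \1_`]r, +oo[ (w (endpoint t0)))) => //.
  - move=> n; apply: measurableT_comp; last exact: measurable_eval.
    by apply: continuous_measurable_fun; exact: continuous_ramp.
  - by move=> n w; exact: ramp_ge0.
  - by move=> w; exact: nd_ramp.
  - by move=> w; exact: cvg_ramp.
have cr : (\int[Q]_w (ramp r n (w (endpoint t0)))%:E)%E @[n --> \oo] -->
    (\int[leb]_y (\1_`]r, +oo[ y * rhoD y)%:E)%E.
  rewrite (_ : (fun n => _) = fun n =>
      (\int[leb]_y (ramp r n y * rhoD y)%:E)%E); last first.
    apply/funext => n; rewrite -integral_rhoD setTI.
    apply: (meander_endpoint_expectation t0 QB).
    - exact: continuous_ramp.
    - by move=> y; exact: ramp_ge0.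
    - by move=> y; exact: ramp_le1.
  apply: (@cvg_integral_nondecreasing _ _ _ leb setT
    (fun n y => ramp r n y * rhoD y) (fun y => \1_`]r, +oo[ y * rhoD y)) => //.
  - move=> n; apply: measurable_funM => //.
    by apply: continuous_measurable_fun; exact: continuous_ramp.
  - by move=> n y; rewrite mulr_ge0// ramp_ge0.
  - by move=> y m n mn; rewrite ler_wpM2r// nd_ramp.
  - by move=> y; apply: cvgM; [exact: cvg_ramp|exact: cvg_cst].
have -> : law `]r, +oo[ = (\int[Q]_w (\1_`]r, +oo[ (w (endpoint t0)))%:E)%E.
  rewrite (_ : (fun w : cpath t => _) = fun w =>
    (\1_((fun w : cpath t => w (endpoint t0)) @^-1` `]r, +oo[) w)%:E)//.
  rewrite integral_indic ?setIT//.
  by rewrite -[X in measurable X]setTI; exact: measurable_eval.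
rewrite -(cvg_lim _ cl)// (cvg_lim _ cr)//.
rewrite /density [RHS]integral_mkcond; apply: eq_integral => y _.
by rewrite patchE indicE; case: (y \in _); rewrite ?mul1r ?mul0r.
Qed.

Let density0 : density set0 = 0%E. Proof. exact: integral_set0. Qed.

Let density_ge0 A : (0 <= density A)%E.
Proof. by apply: integral_ge0 => y _; rewrite lee_fin. Qed.

Let density_sigma_additive : semi_sigma_additive density.
Proof.
move=> F mF tF mUF; rewrite /density ge0_integral_bigcup//; last 2 first.
- exact/measurable_EFinP/measurable_funTS.
- by move=> y _; rewrite lee_fin.
by apply: is_cvg_ereal_nneg_natsum_cond => n _ _; exact: density_ge0.
Qed.

HB.instance Definition _ := isMeasure.Build _ _ _ density
  density0 density_ge0 density_sigma_additive.

HB.instance Definition _ := Measure.copy law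
  (measure_function_pushforward__canonical__measure_function_Measure Q
    (@measurable_eval R t (endpoint t0))).

(** Two measures of the line that agree on open half-lines and are finite there are
    equal. *)
Lemma meander_endpoint_law (A : set R) : measurable A ->
  Q [set w : cpath t | A (w (endpoint t0))] =
  (\int[leb]_(y in A `&` `]v, +oo[)
    (meander_weight mu v t y / meander_mass mu v t)%:E)%E.
Proof.
move=> mA; transitivity (density A); last first.
  have := integral_rhoD A (cst 1); rewrite /density /=.
  under eq_integral do rewrite mul1r.
  by under [in X in _ = X -> _]eq_integral do rewrite mul1r.
change (law A = density A).
have := @measure_unique _ R _ (@RGenOInfty.G R) (fun n => `](- n%:R)%R, +oo[%classic)
  (RGenOInfty.measurableE R) _ _ _ law density.
apply => //.
- move=> _ _ [x ->] [y ->]; exists (Num.max x y).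
  apply/seteqP; split => z /=; rewrite !in_itv/= !andbT gt_max.
    by move=> [-> ->].
  by move=> /andP.
- by move=> n; exists (- n%:R).
- apply/seteqP; split => // y _; exists (Num.truncn `|y|).+1 => //=.
  rewrite in_itv/= andbT ltrNl; apply: le_lt_trans (ler_norm _) _; rewrite normrN.
  by have /andP[] := truncn_itv (normr_ge0 y).
- by move=> _ [r ->]; exact: law_ray.
- move=> n; apply: le_lt_trans (probability_le1 Q _) _; last exact: ltry.
  by rewrite -[X in measurable X]setTI; exact: measurable_eval.
Qed.

End meander_endpoint.

Theorem mainTheorem6 (R : realType) (d : measure_display)
    (Omega : measurableType d) (P : probability Omega R)
    (B : brownian_motion P) (mu v t : R) (t0 : 0 < t) :
  (forall Q : probability (cpath t) R, meander_law B mu v Q ->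
    forall A : set R, measurable A ->
    Q [set w : cpath t | A (w (endpoint t0))] =
    (\int[lebesgue_measure]_(y in A `&` `]v, +oo[)
      ((y - v) * expR (- ((y - v) ^+ 2 / (2 * t))) * expR (mu * y) /
       (\int[lebesgue_measure]_(w in `]v, +oo[)
          ((w - v) * expR (- ((w - v) ^+ 2 / (2 * t))) * expR (mu * w)))%R)%:E)%E)
  /\
  (forall Q : probability (cpath t) R, meander_law B 0 v Q ->
    forall A : set R, measurable A ->
    Q [set w : cpath t | A (w (endpoint t0))] =
    (\int[lebesgue_measure]_(y in A `&` `]v, +oo[)
      ((y - v) / t * expR (- ((y - v) ^+ 2 / (2 * t))))%:E)%E).
Proof.
split=> Q QB A mA; first exact: (meander_endpoint_law t0 QB).
rewrite (meander_endpoint_law t0 QB)//; apply: eq_integral => y _.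
have -> : meander_mass 0 v t = t.
  rewrite /meander_mass /Rintegral -[RHS]/(fine t%:E) -(rayleigh_mass v t0).
  congr fine; apply: eq_integral => w _.
  by rewrite /meander_weight mul0r expR0 mulr1.
by rewrite /meander_weight mul0r expR0 mulr1 mulrAC.
Qed.
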